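(* Suppose that the cost function $\beta$ is $\epsilon$-tame for some $\epsilon<1/4$. Then $S_n^{\mathrm V}/n$ converges to $S$ almost surely as $n\to\infty$.
   Context: Fix $\alpha\in[0,1]$ and a symmetric measurable cost function $\beta:(0,1)\times(0,1)\to[0,\infty)$ ($\beta(u,t)$ is the cost of comparing two keys with seeds $u\neq t$; values on the diagonal are irrelevant). For $0<\epsilon<\infty$, $\beta$ is called $\epsilon$-tame if there is a constant $0<c<\infty$ such that $\beta(u,t)\le c\,(t-u)^{-\epsilon}$ for all $0<u<t<1$. Let $U_1,U_2,\dots$ be i.i.d. uniform$(0,1)$ random variables (the seeds). Put $L_0:=0$, $R_0:=1$ and, inductively for $k\ge 1$, $$\tau_k:=\inf\{i:\ L_{k-1}<U_i<R_{k-1}\},$$ $$L_k:=\mathbf 1(U_{\tau_k}<\alpha)\,U_{\tau_k}+\mathbf 1(U_{\tau_k}>\alpha)\,L_{k-1},\qquad R_k:=\mathbf 1(U_{\tau_k}<\alpha)\,R_{k-1}+\mathbf 1(U_{\tau_k}>\alpha)\,U_{\tau_k}.$$ (Almost surely all $\tau_k$ are finite and no $U_i$ equals $\alpha$.) For $n\ge1$ let $$S_{n,k}:=\sum_{i:\ \tau_k<i\le n}\mathbf 1(L_{k-1}<U_i<R_{k-1})\,\beta(U_i,U_{\tau_k}),\qquad S_n^{\mathrm V}:=\sum_{k\ge1}S_{n,k}.$$ ($S_n^{\mathrm V}$ has the distribution of the total cost of the algorithm QuickVal$(n,\alpha)$.) Further, $$I_k:=\int_{L_{k-1}}^{R_{k-1}}\beta(u,U_{\tau_k})\,du,\qquad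 S:=\sum_{k\ge1}I_k .$$ *)

(* Defs.v *)
From HB Require Import structures.
From mathcomp Require Import all_boot all_order all_algebra finmap.
From mathcomp Require Import all_classical all_reals all_analysis.

Set Implicit Arguments.
Unset Strict Implicit.
Unset Printing Implicit Defensive.

Import Order.TTheory GRing.Theory Num.Theory.
Import numFieldNormedType.Exports.

Local Open Scope classical_set_scope.
Local Open Scope ring_scope.

Section iid_uniform.
Context d (T : measurableType d) (R : realType) (P : probability T R).

Definition mutually_independent (I : choiceType) (X : I -> {RV P >-> R}) :=
  forall (J : {fset I}) (A : I -> set R),
    (forall i, i \in J -> measurable (A i)) ->
    P (\bigcap_(i in [set` J]) (X i @^-1` A i)) =
    (\prod_(i <- J) P (X i @^-1` A i))%E.

Definition iid_uniform01 (U : nat -> {RV P >-> R}) :=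
  mutually_independent U /\
  forall (i : nat) (A : set R), measurable A ->
    distribution P (U i) A = uniform_prob (@ltr01 R) A.

End iid_uniform.

Section cost_function.
Context (R : realType).

(* [beta] is a cost function on (0,1) x (0,1); its values elsewhere are
   unconstrained. *)
Definition cost_function (beta : R -> R -> R) :=
  [/\ measurable_fun ((`]0, 1[ : set R) `*` (`]0, 1[ : set R))
        (fun x : R * R => beta x.1 x.2),
      (forall u t, 0 < u < 1 -> 0 < t < 1 -> 0 <= beta u t) &
      (forall u t, 0 < u < 1 -> 0 < t < 1 -> beta u t = beta t u)].

(* Meant for 0 < eps. *)
Definition tame (eps : R) (beta : R -> R -> R) :=
  exists2 c : R, 0 < c &
    forall u t, 0 < u -> u < t -> t < 1 -> beta u t <= c * (t - u) `^ (- eps).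

End cost_function.

(* [u] is one realization of the seeds, numbered from 0: [u i] is the seed
   usually written U_(i+1), and "i <= n" becomes [i < n]. The steps [k] are
   numbered from 1, as usual. *)
Section quickval.
Context (R : realType) (alpha : R) (beta : R -> R -> R) (u : nat -> R).

(* inf {i | l < u i < r}; the value 0 when there is no such i is arbitrary, and
   for i.i.d. uniform seeds it is used with probability 0. *)
Definition first_in (l r : R) : nat :=
  if pselect (exists i, l < u i < r) is left h then ex_minn h else 0%N.

Fixpoint bounds (k : nat) : R * R :=
  if k is k'.+1 then
    let: (l, r) := bounds k' in
    let p := u (first_in l r) in
    ((p < alpha)%R%:R * p + (p > alpha)%R%:R * l,
     (p < alpha)%R%:R * r + (p > alpha)%R%:R * p)
  else (0, 1).

Definition lo (k : nat) : R := (bounds k).1.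
Definition hi (k : nat) : R := (bounds k).2.
Definition tau (k : nat) : nat := first_in (lo k.-1) (hi k.-1).

Lemma loS k : lo k.+1 = (u (tau k.+1) < alpha)%R%:R * u (tau k.+1) +
                        (u (tau k.+1) > alpha)%R%:R * lo k.
Proof. by rewrite /tau /lo /hi /=; case: (bounds k). Qed.

Lemma hiS k : hi k.+1 = (u (tau k.+1) < alpha)%R%:R * hi k +
                        (u (tau k.+1) > alpha)%R%:R * u (tau k.+1).
Proof. by rewrite /tau /lo /hi /=; case: (bounds k). Qed.

Definition step_cost (n k : nat) : R :=
  \sum_((tau k).+1 <= i < n | lo k.-1 < u i < hi k.-1) beta (u i) (u (tau k)).

Definition quickval_cost (n : nat) : \bar R :=
  (\sum_(1 <= k <oo) (step_cost n k)%:E)%E.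

Definition step_integral (k : nat) : \bar R :=
  (\int[lebesgue_measure]_(x in `]lo k.-1, hi k.-1[) (beta x (u (tau k)))%:E)%E.

Definition quickval_limit : \bar R := (\sum_(1 <= k <oo) step_integral k)%E.

End quickval.

(* Main.v *)
Require Import Defs.
From HB Require Import structures.
From mathcomp Require Import all_boot all_order all_algebra finmap.
From mathcomp Require Import all_classical all_reals all_analysis.
From mathcomp Require Import measurable_realfun zify ring lra.

(* Proof idea. The pivots are the seeds [U_j] that fall in the interval [L_j] alive just before
   [j], so the sum over the steps [k] is a sum over some of the indices [j], and no stopping time
   is needed. With [s_j] the fourth root of the length of [L_j], one step of the interval process
   gives [E s_(j+1) + E s_j^5 / 32 <= E s_j], whence [sum_j E s_j^5 <= 32].
   For a pivot [V = (L_j, U_j)], the centred cost [D_n] of the later comparisons with it is a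
   martingale whose increments have conditional second moment at most [4 c^2 s_j^2] (this is where
   [eps < 1/4] enters: [beta^2 <= c^2 |t - u|^(-1/2)]). Hence
   [Q_j = sum_n (D_(n^2) / n^2)^2 / s_j] satisfies [E Q_j <= C E s_j^5]. Finiteness of [Q_j] gives
   the law of large numbers along squares, hence, by monotonicity, for the cost charged to each
   pivot; and AM-GM bounds that cost divided by [n], uniformly in [n], by
   [2 Q_j + C' s_j 1(U_j in L_j)], whose sum over [j] has finite expectation. Dominated convergence
   for series concludes. *)

Set Implicit Arguments.
Unset Strict Implicit.
Unset Printing Implicit Defensive.

Import Order.TTheory GRing.Theory Num.Theory.
Import numFieldNormedType.Exports.

Local Open Scope classical_set_scope.
Local Open Scope ring_scope.

(** * Seeds and the freezing lemma *)

Section uniform_law.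
Context (R : realType).

Definition idR (x : measurableTypeR R) : R := x.

Lemma measurable_idR : measurable_fun setT idR.
Proof. by move=> _ Y mY; rewrite setTI. Qed.

HB.instance Definition _ := isMeasurableFun.Build _ _ _ _ idR measurable_idR.

(* The library declares [uniform_prob] and [lebesgue_measure] on
   [measurableTypeR R], whose display differs from the one of [R]: the identity
   transports the uniform law to the measurable type of the seeds. *)
Definition uniform01 : probability R R :=
  distribution (uniform_prob (@ltr01 R)) idR.

Lemma ge0_integral_uniform01 (f : R -> \bar R) :
  measurable_fun setT f -> (forall x, (0 <= f x)%E) ->
  (\int[uniform01]_x f x = \int[lebesgue_measure]_(x in `[0%R, 1%R]) f x)%E.
Proof.
move=> mf f0; rewrite /uniform01 ge0_integral_distribution//.
by rewrite integral_uniform//= subr0 invr1 mul1e.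
Qed.

Lemma integral_uniform01_cst (r : R) : (\int[uniform01]_u r%:E = r%:E)%E.
Proof.
have Q1 : (uniform01 setT = 1)%E by exact: probability_setT.
by rewrite (integral_cst uniform01 measurableT r%:E) [X in (_ * X)%E]Q1 mule1.
Qed.

End uniform_law.

Section history.
Context d (T : measurableType d) (R : realType) (P : probability T R).
Variable U : nat -> {RV P >-> R}.

(** Cylinders on the seeds before [m]: a pi-system that generates the sigma-algebra of the first [m]
    seeds. *)
Definition history (m : nat) : set (set T) :=
  [set C | exists2 A : nat -> set R, (forall i, measurable (A i)) &
    C = \bigcap_(i < m) (U i @^-1` A i)].

Lemma history_setI m : setI_closed (history m).
Proof.
move=> _ _ [A mA ->] [B mB ->]; exists (fun i => A i `&` B i).
  by move=> i; exact: measurableI.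
by rewrite -bigcapI; apply: eq_bigcapr => i _; rewrite preimage_setI.
Qed.

Lemma history_setT m : history m setT.
Proof.
by exists (fun=> setT) => //; apply/esym/seteqP; split.
Qed.

Lemma sub_history m n : (m <= n)%N -> history m `<=` history n.
Proof.
move=> mn _ [A mA ->].
exists (fun i => if (i < m)%N then A i else setT).
  by move=> i; case: ifP.
apply/seteqP; split => w Aw i /= ilt.
  by case: ifPn => // im; exact: Aw.
by move: (Aw i (leq_trans ilt mn)) => /=; rewrite ilt.
Qed.

Lemma measurable_history m C : <<s history m >> C -> measurable C.
Proof.
apply: smallest_sub; first exact: sigma_algebra_measurable.
move=> _ [A mA ->]; apply: bigcap_measurableType => i _.
by rewrite -[X in measurable X]setTI; exact: measurable_funPT.
Qed.

Definition adapted d' (T' : measurableType d') m (X : T -> T') :=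
  @measurable_fun _ _ (g_sigma_algebraType (history m)) T' setT X.

Lemma adapted_measurable d' (T' : measurableType d') m (X : T -> T') :
  adapted m X -> measurable_fun setT X.
Proof.
move=> mX _ Y mY; rewrite setTI; apply: (@measurable_history m).
by have := mX measurableT Y mY; rewrite setTI.
Qed.

Lemma adapted_le d' (T' : measurableType d') m n (X : T -> T') :
  (m <= n)%N -> adapted m X -> adapted n X.
Proof.
move=> mn mX _ Y mY; have := mX measurableT Y mY.
by apply: sub_sigma_algebra2; exact: sub_history.
Qed.

Lemma adapted_seed m : adapted m.+1 (U m).
Proof.
move=> _ Y mY; apply: sub_sigma_algebra.
exists (fun i => if i == m then Y else setT) => [i|]; first by case: ifP.
rewrite setTI; apply/seteqP; split => w /= Yw.
  by move=> i _ /=; case: eqP => // ->.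
by have := Yw m (ltnSn m) => /=; rewrite eqxx.
Qed.

Lemma adapted_comp d1 d2 (T1 : measurableType d1) (T2 : measurableType d2) m
    (f : T1 -> T2) (X : T -> T1) :
  measurable_fun setT f -> adapted m X -> adapted m (fun w => f (X w)).
Proof. by move=> mf mX; exact: (measurableT_comp mf mX). Qed.

Lemma adapted_pair d1 d2 (T1 : measurableType d1) (T2 : measurableType d2) m
    (X : T -> T1) (Y : T -> T2) :
  adapted m X -> adapted m Y -> adapted m (fun w => (X w, Y w)).
Proof. by move=> mX mY; exact: measurable_fun_pair. Qed.

(** For fixed [B] both sides are finite measures in [E]: a restriction of [P] and a multiple of [P].
    They agree on cylinders by independence, hence on the sigma-algebra generated by them. *)
Lemma history_independent m E B : mutually_independent U ->
  <<s history m >> E -> measurable B ->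
  P (E `&` U m @^-1` B) = (P E * P (U m @^-1` B))%E.
Proof.
move=> indU mE mB.
have mUB : measurable (U m @^-1` B).
  by rewrite -[X in measurable X]setTI; exact: measurable_funPT.
have p0 : 0 <= fine (P (U m @^-1` B)) by exact: fine_ge0.
pose m1 := mrestr P mUB; pose m2 := mscale (NngNum p0) P.
have PUB : (fine (P (U m @^-1` B)))%:E = P (U m @^-1` B).
  by rewrite fineK// fin_num_measure.
have m2E A : m2 A = (P (U m @^-1` B) * P A)%E by rewrite -PUB.
rewrite muleC -m2E.
apply: (@g_sigma_algebra_measure_unique _ _ _ (history m) _ (fun=> setT)
  _ _ m1 m2 _ _ _ E mE).
- by move=> C HC; apply: (@measurable_history m); exact: sub_sigma_algebra.
- by move=> _; exact: history_setT.
- by rewrite bigcup_const//; exists 0%N.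
- exact: history_setI.
- move=> _ [A mA ->]; transitivity (P (U m @^-1` B) * P (\bigcap_(i < m) (U i @^-1` A i)))%E;
    last exact/esym/m2E.
  rewrite /m1 /= /mrestr.
  have ind n (A' : nat -> set R) : (forall i, measurable (A' i)) ->
      P (\bigcap_(i < n) (U i @^-1` A' i)) =
      (\prod_(i <- [fset j | j in iota 0 n]%fset) P (U i @^-1` A' i))%E.
    move=> mA'; rewrite -indU//; congr (P (bigcap _ _)).
    by apply/seteqP; split => i /=; rewrite !inE mem_iota.
  (* Intersecting with the event on the seed [m] gives a cylinder of length [m.+1]. *)
  have -> : \bigcap_(i < m) (U i @^-1` A i) `&` U m @^-1` B =
      \bigcap_(i < m.+1) (U i @^-1` (if i == m then B else A i)).
    apply/seteqP; split => [w [Aw Bw] i /=|w Aw].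
      by rewrite ltnS leq_eqVlt; case: eqP => [->//|_ /= im]; exact: Aw.
    split=> [i /= im|]; last by have := Aw m (ltnSn m); rewrite eqxx.
    by have := Aw i (ltnW im) => /=; rewrite lt_eqF.
  rewrite (ind m.+1 (fun i => if i == m then B else A i)); last first.
    by move=> i; case: ifP.
  rewrite ind//.
  have e n : perm_eq (enum_fset [fset j | j in iota 0 n]%fset) (iota 0 n).
    apply: uniq_perm; rewrite ?fset_uniq ?iota_uniq// => i.
    by rewrite !inE.
  rewrite !(perm_big _ (e _)).
  have -> : iota 0 m.+1 = iota 0 m ++ [:: m] by rewrite -addn1 iotaD.
  rewrite big_cat big_seq1 eqxx muleC.
  congr (_ * _)%E; rewrite big_seq [RHS]big_seq; apply: eq_bigr => i.
  by rewrite mem_iota add0n => /= im; rewrite lt_eqF.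
- by move=> _; rewrite /m1/= (le_lt_trans (probability_le1 _ _)) ?ltry//; exact: measurableI.
Qed.

Hypothesis iidU : iid_uniform01 U.

(** This stands for conditioning on the first [m] seeds: [X] is independent of [U m], so their joint
    law is a product and Tonelli applies. *)
Lemma freezing d' (T' : measurableType d') m (X : T -> T')
    (f : T' * R -> \bar R) :
  adapted m X -> measurable_fun setT f -> (forall x, (0 <= f x)%E) ->
  (\int[P]_w f (X w, U m w) = \int[P]_w \int[(uniform01 R)]_u f (X w, u))%E.
Proof.
move=> aX mf f0; have [indU disU] := iidU.
have mX := adapted_measurable aX.
pose XX : {mfun T >-> T'} := HB.pack X (isMeasurableFun.Build _ _ _ _ _ mX).
have mXU : measurable_fun setT (fun w => (X w, U m w)).
  by apply: measurable_fun_pair => //; exact: measurable_funPT.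
pose XU : {mfun T >-> (T' * R)%type} :=
  HB.pack (fun w => (X w, U m w)) (isMeasurableFun.Build _ _ _ _ _ mXU).
rewrite -[LHS](@ge0_integral_distribution _ _ _ _ _ P XU)//.
transitivity (\int[distribution P XX \x uniform01 R]_z f z)%E.
  apply: eq_measure_integral => A mA _; apply/esym/product_measure_unique => //.
  move=> C D mC mD /=; rewrite -[uniform01 R D](disU m)// /distribution /pushforward.
  rewrite -history_independent//.
  by have := aX measurableT C mC; rewrite setTI.
rewrite fubini_tonelli1// [LHS](@ge0_integral_distribution _ _ _ _ _ P XX)//.
- exact: measurable_fun_fubini_tonelli_F.
- by move=> y; exact: integral_ge0.
Qed.

End history.

(** * The integral of the inverse square root *)

Section inverse_sqrt_integral.
Context (R : realType).
Local Notation leb := (@lebesgue_measure R).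

(** As [f] may blow up at the ends, the fundamental theorem of calculus is applied on compact
    subintervals, and monotone convergence exhausts []a, b[]. Bounding the increments of [F] avoids
    its limits at the ends. *)
Lemma ge0_integral_oo_le (f F : R -> R) (a b M : R) : a < b ->
  measurable_fun setT f -> (forall x, 0 <= f x) ->
  (forall x, a < x < b -> is_derive x 1 F (f x)) ->
  (forall x, a < x < b -> {for x, continuous f}) ->
  (forall x y, a < x < b -> a < y < b -> F y - F x <= M) ->
  (\int[leb]_(x in `]a, b[) (f x)%:E <= M%:E)%E.
Proof.
move=> ab mf f0 dF cf FM.
(* The denominator [n.+3] keeps [a + e n < b - e n] even for [n = 0]. *)
pose e (n : nat) : R := (b - a) / n.+3%:R.
have e0 n : 0 < e n by rewrite divr_gt0 ?subr_gt0.
have eab n : a + e n < b - e n.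
  have : e n * 2 < b - a.
    by rewrite /e mulrAC ltr_pdivrMr// ltr_pM2l ?subr_gt0// ltr_nat.
  by rewrite mulr_natr mulr2n; lra.
pose J n : set R := `[a + e n, b - e n]%classic.
have le_e m n : (m <= n)%N -> e n <= e m.
  move=> mn; rewrite /e ler_pM2l ?subr_gt0// lef_pV2 ?posrE//.
  by rewrite ler_nat !ltnS.
have Jab : `]a, b[%classic = \bigcup_n J n.
  apply/seteqP; split=> [x|x [n _]]; rewrite /J /= !in_itv/=.
    move=> /andP[ax xb].
    have [p p0] : exists2 p : R, 0 < p & p <= x - a /\ p <= b - x.
      exists (Num.min (x - a) (b - x)).
        by rewrite lt_min !subr_gt0 ax.
      by rewrite !ge_min !lexx orbT.
    move=> [pa pb].
    pose k := Num.truncn ((b - a) / p).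
    exists k => //; rewrite /= in_itv/=.
    have : e k <= p.
      rewrite /e ler_pdivrMr// mulrC -ler_pdivrMr//.
      have := truncnS_gt ((b - a) / p).
      move=> /ltW/le_trans; apply; rewrite ler_nat -/k; lia.
    by move=> ekp; apply/andP; split; lra.
  move=> /andP[ax xb]; move: (e0 n) => ?; apply/andP; split; lra.
have mJ n : measurable (J n) by exact: measurable_itv.
have ndJ : nondecreasing_seq J.
  move=> m n mn; apply/subsetPset => x; rewrite /J /= !in_itv/= => /andP[ax xb].
  have := le_e _ _ mn => ?; apply/andP; split; lra.
have cvgJ := @ge0_nondecreasing_set_cvg_integral _ (measurableTypeR R) R J
  (fun x => (f x)%:E) leb ndJ mJ
  (fun n => measurable_funTS (proj2 (measurable_EFinP setT f) mf))
  (fun n x _ => f0 x).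
rewrite Jab -(cvg_lim _ cvgJ)//; apply: lime_le; first by apply/cvg_ex; eexists; exact: cvgJ.
apply: nearW => n; rewrite /J.
have sub x : x \in `[a + e n, b - e n] -> a < x < b.
  rewrite in_itv/= => /andP[ax xb]; move: (e0 n) => ?; apply/andP; split; lra.
rewrite (@continuous_FTC2 _ f F)//.
- rewrite -EFinB lee_fin FM//; apply: sub; rewrite in_itv/= lexx ltW//.
- apply: continuous_in_subspaceT => x; rewrite inE/= => xab; exact/cf/sub.
- split.
  + move=> x xab; have /dF[] : a < x < b by apply: sub; exact: (subset_itv_oo_cc xab).
    by [].
  + apply: cvg_at_right_filter; apply: differentiable_continuous.
    apply/derivable1_diffP; have /dF[] : a < a + e n < b.
      by apply: sub; rewrite in_itv/= lexx ltW.
    by [].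
  + apply: cvg_at_left_filter; apply: differentiable_continuous.
    apply/derivable1_diffP; have /dF[] : a < b - e n < b.
      by apply: sub; rewrite in_itv/= lexx ltW.
    by [].
- move=> x xab; have [_ <-] := dF x (sub x (subset_itv_oo_cc xab)).
  by rewrite derive1E.
Qed.

Lemma measurable_powR_comp d (T : measurableType d) (f : T -> R) (p : R) :
  measurable_fun setT f -> measurable_fun setT (fun x => f x `^ p).
Proof. by move=> mf; apply: (measurableT_comp (measurable_powR p)). Qed.

Lemma is_derive_powR_sub (t x p : R) : t < x ->
  is_derive x 1 (fun u => (u - t) `^ p) (p * (x - t) `^ (p - 1)).
Proof.
move=> tx.
have d1 : is_derive x 1 (fun u : R => u - t) 1.
  by rewrite -[X in is_derive _ _ _ X]subr0; apply: is_deriveB.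
have d2 : is_derive (x - t) 1 (fun v : R => v `^ p) (p * (x - t) `^ (p - 1)).
  by apply: is_derive1_powR; rewrite subr_gt0.
by have := @is_derive1_comp R (fun v : R => v `^ p) (fun u : R => u - t) x _ _ d2 d1; rewrite mulr1.
Qed.

Lemma is_derive_powR_subr (t x p : R) : x < t ->
  is_derive x 1 (fun u => (t - u) `^ p) (- (p * (t - x) `^ (p - 1))).
Proof.
move=> tx.
have d1 : is_derive x 1 (fun u : R => t - u) (- 1).
  by rewrite -[X in is_derive _ _ _ X]add0r; apply: is_deriveB.
have d2 : is_derive (t - x) 1 (fun v : R => v `^ p) (p * (t - x) `^ (p - 1)).
  by apply: is_derive1_powR; rewrite subr_gt0.
by have := @is_derive1_comp R (fun v : R => v `^ p) (fun u : R => t - u) x _ _ d2 d1;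
  rewrite mulrN1.
Qed.

Lemma is_derive_continuous (f : R -> R) (x l : R) : is_derive x 1 f l -> {for x, continuous f}.
Proof.
by move=> [dfx _]; apply: differentiable_continuous; exact/derivable1_diffP.
Qed.

Lemma integral_invsqrt_right (t r : R) : t < r ->
  (\int[leb]_(u in `]t, r[) ((u - t) `^ (- 2^-1))%:E <= (2 * (r - t) `^ 2^-1)%:E)%E.
Proof.
move=> tr; apply: (@ge0_integral_oo_le (fun u => (u - t) `^ (- 2^-1))
  (fun u => 2 * (u - t) `^ 2^-1)) => //.
- by apply: measurable_powR_comp; exact: measurable_funB.
- by move=> x; exact: powR_ge0.
- move=> x /andP[tx _]; have := is_derive_powR_sub 2^-1 tx.
  move=> h; have := is_deriveZ 2 h; rewrite /GRing.scale/= mulrA mulfV// mul1r.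
  by rewrite (_ : 2^-1 - 1 = - 2^-1 :> R)//; lra.
- by move=> x /andP[tx _]; apply: is_derive_continuous (is_derive_powR_sub _ tx).
- move=> x y /andP[tx xr] /andP[ty yr].
  rewrite lerBlDr ler_wpDr ?mulr_ge0 ?powR_ge0// ler_pM2l//.
  by apply: ge0_ler_powR; rewrite ?nnegrE//; lra.
Qed.

Lemma integral_invsqrt_left (l t : R) : l < t ->
  (\int[leb]_(u in `]l, t[) ((t - u) `^ (- 2^-1))%:E <= (2 * (t - l) `^ 2^-1)%:E)%E.
Proof.
move=> lt; apply: (@ge0_integral_oo_le (fun u => (t - u) `^ (- 2^-1))
  (fun u => - 2 * (t - u) `^ 2^-1)) => //.
- by apply: measurable_powR_comp; exact: measurable_funB.
- by move=> x; exact: powR_ge0.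
- move=> x /andP[_ tx]; have := is_derive_powR_subr 2^-1 tx.
  move=> h; have := is_deriveZ (- 2) h; rewrite /GRing.scale/= mulrNN mulrA mulfV// mul1r.
  by rewrite (_ : 2^-1 - 1 = - 2^-1 :> R)//; lra.
- by move=> x /andP[_ tx]; apply: is_derive_continuous (is_derive_powR_subr _ tx).
- move=> x y /andP[tx xr] /andP[ty yr].
  rewrite !mulNr opprK addrC lerBlDr ler_wpDr ?mulr_ge0 ?powR_ge0// ler_pM2l//.
  by apply: ge0_ler_powR; rewrite ?nnegrE//; lra.
Qed.

End inverse_sqrt_integral.

(** * The interval process *)

Section interval_process.
Context (R : realType) (alpha : R).

(** A seed equal to [alpha] counts as lying on the right, which keeps the interval [valid] whatever
    the seed. *)
Definition shrink (st : R * R) (p : R) : R * R :=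
  if (st.1 < p) && (p < st.2) then
    (if p < alpha then (p, st.2) else (st.1, p))
  else st.

Definition valid (st : R * R) := [/\ 0 <= st.1, st.1 <= alpha, alpha <= st.2 & st.2 <= 1].

Definition root4 (st : R * R) : R := (st.2 - st.1) `^ 4^-1.

(* If the seed [p] falls in one of the two intervals, half of that side of [alpha] is lost; as
   [4 x^3 (x - y) >= x^4 - y^4], [root4] then decreases by at least [gain]. *)
Definition gain (st : R * R) (p : R) : R :=
  ((alpha - st.1) / 2 * \1_(`]st.1 + (alpha - st.1) / 2, alpha[%classic) p +
   (st.2 - alpha) / 2 * \1_(`]alpha, st.2 - (st.2 - alpha) / 2[%classic) p)
  * ((st.2 - st.1) `^ (- 4^-1)) ^+ 3 / 4.

Lemma shrink_valid st p : valid st -> valid (shrink st p).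
Proof.
move=> [l0 la ar r1]; rewrite /shrink; case: ifP => // /andP[lp pr].
by case: ltP => pa; split => //=; lra.
Qed.

Lemma root4_ge0 st : 0 <= root4 st.
Proof. exact: powR_ge0. Qed.

Lemma root4_pow4 st : st.1 <= st.2 -> root4 st ^+ 4 = st.2 - st.1.
Proof.
move=> lr; rewrite /root4 -powR_mulrn ?powR_ge0// -powRrM mulVf// powRr1//; lra.
Qed.

Lemma root4_pow2 st : root4 st ^+ 2 = (st.2 - st.1) `^ 2^-1.
Proof.
rewrite /root4 -powR_mulrn ?powR_ge0// -powRrM; congr (_ `^ _); lra.
Qed.

Lemma valid_le st : valid st -> st.1 <= st.2.
Proof. by move=> [? ? ? ?]; lra. Qed.

Lemma root4_le1 st : valid st -> root4 st <= 1.
Proof.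
move=> vst; have lr := valid_le vst; rewrite -(@ler_pXn2r _ 4) ?nnegrE ?root4_ge0//.
by rewrite root4_pow4// expr1n; move: vst => [? ? ? ?]; lra.
Qed.

Lemma gain_ge0 st p : valid st -> 0 <= gain st p.
Proof.
move=> [l0 la ar r1]; rewrite /gain divr_ge0// mulr_ge0 ?exprn_ge0 ?powR_ge0//.
by rewrite addr_ge0// mulr_ge0 ?divr_ge0//; lra.
Qed.

Lemma shrink_gain st p : valid st -> root4 (shrink st p) + gain st p <= root4 st.
Proof.
move=> vst; have lr := valid_le vst; have lr' := valid_le (shrink_valid p vst).
have xE := root4_pow4 lr; have yE := root4_pow4 lr'.
have [l0 la ar r1] := vst.
rewrite /gain powRN -/(root4 st).
set x := root4 st in xE *; set y := root4 _ in yE *.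
have x0 : 0 <= x := root4_ge0 st; have y0 : 0 <= y := root4_ge0 _.
set G := (X in X * _ / _).
(* [G] is at most the lost length: a seed in the half of a side nearer to [alpha] cuts off at least
   the other half. *)
have GE : G <= x ^+ 4 - y ^+ 4.
  rewrite xE yE /G !indicE !mem_setE !in_itv/= /shrink; set l := st.1; set r := st.2.
  case: (boolP (l + (alpha - l) / 2 < p < alpha)) => [/andP[p1 p2]|_];
  case: (boolP (alpha < p < r - (r - alpha) / 2)) => [/andP[p3 p4]|_];
  (case: ifP => [/andP[q1 q2]|/negbT]; [case: ltP => q3|rewrite negb_and -!leNgt => /orP[q1|q1]]);
  rewrite /= -/l -/r; lra.
(* On a degenerate interval the gain vanishes, since [0^-1 = 0]. *)
have [x_eq0|x_neq0] := eqVneq x 0.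
  have y_eq0 : y = 0.
    have xx : x ^+ 4 = 0 by rewrite x_eq0 expr0n.
    have : y ^+ 4 <= 0.
      rewrite yE; move: xE; rewrite xx; rewrite /shrink; case: ifP => [/andP[? ?]|_] /=.
        by case: ifP => _ /=; lra.
      by lra.
    by rewrite exprn_even_le0//= => /eqP.
  by rewrite x_eq0 y_eq0 invr0 expr0n /= mulr0 mul0r addr0.
have xp : 0 < x by rewrite lt_neqAle eq_sym x_neq0.
have x3 : 0 < x ^+ 3 by rewrite exprn_gt0.
rewrite -lerBrDl exprVn -mulrA -invfM ler_pdivrMr ?mulr_gt0//.
apply: (le_trans GE); rewrite -subr_ge0.
(* Convexity of the fourth power, as a factorization into nonnegative terms. *)
have -> : (x - y) * (x ^+ 3 * 4) - (x ^+ 4 - y ^+ 4) =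
  (x - y) ^+ 2 * (2 * x ^+ 2 + (x + y) ^+ 2) by ring.
apply: mulr_ge0; first exact: sqr_ge0.
by apply: addr_ge0; [apply: mulr_ge0 => //|]; exact: sqr_ge0.
Qed.

(** Each indicator has probability half the length of its side. With [x] the fourth root of [r - l],
    the integral is [((alpha - l)^2 + (r - alpha)^2) / (16 x^3)], and [a^2 + b^2 >= (a + b)^2 / 2]
    concludes. *)
Lemma integral_gain st : valid st ->
  ((32^-1 * root4 st ^+ 5)%:E <= \int[uniform01 R]_p (gain st p)%:E)%E.
Proof.
move=> vst; have [l0 la ar r1] := vst; have lr := valid_le vst.
set l := st.1 in l0 la lr *; set r := st.2 in ar r1 lr *.
pose K := ((r - l) `^ (- 4^-1)) ^+ 3 / 4.
have K0 : 0 <= K by rewrite divr_ge0 ?exprn_ge0 ?powR_ge0.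
pose a := (alpha - l) / 2 * K; pose b := (r - alpha) / 2 * K.
have a0 : 0 <= a by rewrite mulr_ge0//; lra.
have b0 : 0 <= b by rewrite mulr_ge0//; lra.
pose I1 := `]l + (alpha - l) / 2, alpha[%classic : set R.
pose I2 := `]alpha, r - (r - alpha) / 2[%classic : set R.
have gE p : (gain st p)%:E = (a%:E * (\1_I1 p)%:E + b%:E * (\1_I2 p)%:E)%E.
  rewrite /gain -/l -/r -/I1 -/I2 -!EFinM -EFinD; congr EFin.
  by rewrite /a /b /K; ring.
have mI1 : measurable I1 by exact: measurable_itv.
have mI2 : measurable I2 by exact: measurable_itv.
have m1 (D : set R) : measurable D ->
  measurable_fun (setT : set R) (fun p => (\1_D p)%:E : \bar R).
  by move=> mD; apply/measurable_EFinP; exact: measurable_indic.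
under eq_integral do rewrite gE.
rewrite ge0_integralD//; last 4 first.
- by move=> p _; rewrite mule_ge0// lee_fin.
- by apply: measurable_funeM; exact: m1.
- by move=> p _; rewrite mule_ge0// lee_fin.
- by apply: measurable_funeM; exact: m1.
rewrite !ge0_integralZl//; do ?[exact: m1].
rewrite !ge0_integral_uniform01//; do ?[exact: m1].
rewrite !integral_indic//.
rewrite !setIidl; last 2 first.
- by move=> p; rewrite /I2 /= !in_itv/= => /andP[? ?]; apply/andP; split; lra.
- by move=> p; rewrite /I1 /= !in_itv/= => /andP[? ?]; apply/andP; split; lra.
rewrite /I1 /I2 /= !lebesgue_measure_itv/= !lte_fin.
have -> : (if l + (alpha - l) / 2 < alpha then (alpha%:E - (l + (alpha - l) / 2)%:E)%E else 0%E)
    = ((alpha - l) / 2)%:E.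
  by case: ifPn => h; rewrite -?EFinB; congr EFin; lra.
have -> : (if alpha < r - (r - alpha) / 2 then ((r - (r - alpha) / 2)%:E - alpha%:E)%E else 0%E)
    = ((r - alpha) / 2)%:E.
  by case: ifPn => h; rewrite -?EFinB; congr EFin; lra.
rewrite -!EFinM -EFinD lee_fin /a /b /K powRN.
have xE : root4 st ^+ 4 = r - l by exact: root4_pow4.
have -> : (r - l) `^ 4^-1 = root4 st by [].
set x := root4 st in xE *.
have [->|x0] := eqVneq x 0; first by rewrite expr0n mulr0 invr0 expr0n/= !(mul0r, mulr0) addr0.
have -> : x ^+ 5 = (r - l) ^+ 2 * x^-1 ^+ 3 by rewrite -xE; field.
have -> : (alpha - l) / 2 * (x^-1 ^+ 3 / 4) * ((alpha - l) / 2) +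
   (r - alpha) / 2 * (x^-1 ^+ 3 / 4) * ((r - alpha) / 2) =
   ((alpha - l) ^+ 2 + (r - alpha) ^+ 2) / 16 * x^-1 ^+ 3 by field.
rewrite mulrA ler_wpM2r ?exprn_ge0 ?invr_ge0 ?root4_ge0//.
rewrite -subr_ge0.
have -> : ((alpha - l) ^+ 2 + (r - alpha) ^+ 2) / 16 - 32^-1 * (r - l) ^+ 2 =
  ((alpha - l) - (r - alpha)) ^+ 2 / 32 by field.
by rewrite divr_ge0 ?sqr_ge0.
Qed.

Lemma measurable_root4 : measurable_fun setT root4.
Proof. by apply: measurable_powR_comp; exact: measurable_funB. Qed.

Lemma measurable_gain : measurable_fun setT (fun x : (R * R) * R => gain x.1 x.2).
Proof.
have mfst : measurable_fun setT (fun x : (R * R) * R => x.1.1).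
  exact: (measurableT_comp measurable_fst measurable_fst).
have msnd : measurable_fun setT (fun x : (R * R) * R => x.1.2).
  exact: (measurableT_comp measurable_snd measurable_fst).
have mp : measurable_fun setT (fun x : (R * R) * R => x.2) by exact: measurable_snd.
have mind (f g : (R * R) * R -> R) : measurable_fun setT f -> measurable_fun setT g ->
  measurable_fun setT (fun x : (R * R) * R => \1_(`]f x, g x[%classic) x.2 : R).
  move=> mf mg.
  have -> : (fun x : (R * R) * R => \1_(`]f x, g x[%classic) x.2 : R) =
     (fun x => if (f x < x.2) && (x.2 < g x) then 1 else 0).
    by apply/funext => x; rewrite indicE mem_setE in_itv/=; case: ifP.
  by apply: measurable_fun_ifT => //; apply: measurable_and; exact: measurable_fun_ltr.
rewrite /gain; apply: measurable_funM; last exact: measurable_cst.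
apply: measurable_funM; last first.
  by apply: measurable_funX; apply: measurable_powR_comp; exact: measurable_funB.
apply: measurable_funD.
  apply: measurable_funM.
    by apply: measurable_funM => //; exact: measurable_funB.
  apply: mind => //; apply: measurable_funD => //.
  by apply: measurable_funM => //; exact: measurable_funB.
apply: measurable_funM.
  by apply: measurable_funM => //; exact: measurable_funB.
apply: mind => //; apply: measurable_funB => //.
by apply: measurable_funM => //; exact: measurable_funB.
Qed.

Lemma measurable_shrink : measurable_fun setT (fun x : (R * R) * R => shrink x.1 x.2).
Proof.
have mfst : measurable_fun setT (fun x : (R * R) * R => x.1.1).
  exact: (measurableT_comp measurable_fst measurable_fst).
have msnd : measurable_fun setT (fun x : (R * R) * R => x.1.2).
  exact: (measurableT_comp measurable_snd measurable_fst).
have mp : measurable_fun setT (fun x : (R * R) * R => x.2) by exact: measurable_snd.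
apply: measurable_fun_ifT.
- by apply: measurable_and; exact: measurable_fun_ltr.
- apply: measurable_fun_ifT.
  + exact: measurable_fun_ltr.
  + exact: measurable_fun_pair.
  + exact: measurable_fun_pair.
- exact: measurable_fst.
Qed.

End interval_process.

(** * The cost charged to one pivot *)

Section comparison_cost.
Context (R : realType) (beta : R -> R -> R) (eps c : R).
Hypothesis hbeta : cost_function beta.
Hypotheses (heps4 : eps < 1 / 4) (c0 : 0 < c).
Hypothesis hc : forall u t, 0 < u -> u < t -> t < 1 -> beta u t <= c * (t - u) `^ (- eps).
Local Notation leb := (@lebesgue_measure R).

(* A pivot [V = ((l, r), t)] is a point [t] together with the interval in which it falls. *)
Definition pivot (V : (R * R) * R) : bool :=
  [&& 0 <= V.1.1, V.1.2 <= 1, V.1.1 < V.2 & V.2 < V.1.2].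

(** The value [0] off pivots lets sums run over all indices while only pivots contribute. *)
Definition cost (V : (R * R) * R) (u : R) : R :=
  if pivot V && (V.1.1 < u < V.1.2) then beta u V.2 else 0.

Definition mean_cost (V : (R * R) * R) : R := fine (\int[uniform01 R]_u (cost V u)%:E)%E.

Lemma cost_ge0 V u : 0 <= cost V u.
Proof.
rewrite /cost; case: ifP => // /andP[/and4P[l0 r1 lt tr] /andP[lu ur]].
by case: hbeta => _ + _; apply; apply/andP; split; lra.
Qed.

Lemma cost_npivot V u : ~~ pivot V -> cost V u = 0.
Proof. by rewrite /cost => /negbTE ->. Qed.

Lemma measurable_pivot : measurable_fun setT pivot.
Proof.
have mfst : measurable_fun setT (fun x : (R * R) * R => x.1.1).
  exact: (measurableT_comp measurable_fst measurable_fst).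
have msnd : measurable_fun setT (fun x : (R * R) * R => x.1.2).
  exact: (measurableT_comp measurable_snd measurable_fst).
by apply: measurable_and; [|apply: measurable_and; [|apply: measurable_and]];
  (exact: measurable_fun_ler || exact: measurable_fun_ltr).
Qed.

(** [beta] is measurable on the open unit square only; the set [D] outside which [cost] vanishes is
    measurable and is sent into that square. *)
Lemma measurable_cost :
  measurable_fun setT (fun x : ((R * R) * R) * R => cost x.1 x.2).
Proof.
have mfst : measurable_fun setT (fun x : ((R * R) * R) * R => x.1.1.1).
  exact: (measurableT_comp measurable_fst (measurableT_comp measurable_fst measurable_fst)).
have msnd : measurable_fun setT (fun x : ((R * R) * R) * R => x.1.1.2).
  exact: (measurableT_comp measurable_snd (measurableT_comp measurable_fst measurable_fst)).
have mt : measurable_fun setT (fun x : ((R * R) * R) * R => x.1.2).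
  exact: (measurableT_comp measurable_snd measurable_fst).
pose D := [set x : ((R * R) * R) * R | pivot x.1 && (x.1.1.1 < x.2 < x.1.1.2)].
have mD : measurable D.
  have mb : measurable_fun setT (fun x : ((R * R) * R) * R =>
      pivot x.1 && (x.1.1.1 < x.2 < x.1.1.2)).
    apply: measurable_and.
      exact: (measurableT_comp measurable_pivot measurable_fst).
    by apply: measurable_and; exact: measurable_fun_ltr.
  by have := mb measurableT [set true] I; rewrite setTI.
have -> : (fun x : ((R * R) * R) * R => cost x.1 x.2) =
    (fun x => beta x.2 x.1.2) \_ D.
  by apply/funext => x; rewrite patchE /cost mem_setE.
apply/(measurable_restrictT _ mD).
case: hbeta => mb _ _.
apply: (measurable_comp (F := (`]0, 1[ : set R) `*` (`]0, 1[ : set R))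
  (f := fun x : R * R => beta x.1 x.2) (g := fun x => (x.2, x.1.2))) => //.
- by apply: measurableX; exact: measurable_itv.
- move=> _ [x /andP[/and4P[l0 r1 lt tr] /andP[lu ur]] <-] /=.
  by rewrite !in_itv/=; split; apply/andP; split; lra.
- by apply: measurable_funTS; exact: measurable_fun_pair.
Qed.

Lemma measurable_cost2 V : measurable_fun setT (cost V).
Proof. exact: (measurableT_comp measurable_cost (pair1_measurable V)). Qed.

Lemma measurable_mean_cost : measurable_fun setT mean_cost.
Proof.
have mF : measurable_fun setT (fubini_F (uniform01 R) (fun x => (cost x.1 x.2)%:E)).
  apply: measurable_fun_fubini_tonelli_F => [|x].
    apply/measurable_EFinP. exact: measurable_cost.
  by rewrite lee_fin cost_ge0.
exact: (measurableT_comp (fine_measurable measurableT) mF).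
Qed.

(** Squaring gives the exponent [- 2 eps], which exceeds [- 1/2], and the base [t - u] lies in []0,
    1[]. *)
Lemma tame_square u t : 0 < u -> u < t -> t < 1 ->
  beta u t ^+ 2 <= c ^+ 2 * (t - u) `^ (- 2^-1).
Proof.
move=> u0 ut t1.
have b0 : 0 <= beta u t by case: hbeta => _ + _; apply; apply/andP; split; lra.
have := hc u0 ut t1; rewrite -(@ler_pXn2r _ 2) ?nnegrE//; last first.
  by rewrite mulr_ge0 ?powR_ge0// ltW.
move=> /le_trans; apply; rewrite exprMn ler_pM2l ?exprn_gt0//.
rewrite -powR_mulrn ?powR_ge0// -powRrM; apply: ger_powR; last by move: heps4; lra.
by apply/andP; split; lra.
Qed.

(** The inverse square root of the distance to the point [V.2], split there so that each side has an
    explicit antiderivative. *)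
Let near_cost (V : (R * R) * R) (u : R) : R :=
  (((fun v => (V.2 - v) `^ (- 2^-1)) \_ (`]V.1.1, V.2[%classic : set R)) u +
   ((fun v => (v - V.2) `^ (- 2^-1)) \_ (`]V.2, V.1.2[%classic : set R)) u).

Let near_cost_ge0 V u : 0 <= near_cost V u.
Proof. by rewrite /near_cost !patchE; do 2!case: ifP => _; rewrite ?addr_ge0 ?powR_ge0. Qed.

Let cost_square_near V u : u != V.2 -> cost V u ^+ 2 <= c ^+ 2 * near_cost V u.
Proof.
move=> ut; rewrite /cost; case: ifPn => [|_]; last first.
  by rewrite expr0n mulr_ge0 ?sqr_ge0.
move=> /andP[/and4P[l0 r1 lt tr] /andP[lu ur]].
rewrite /near_cost !patchE !mem_setE !in_itv/= lu ur andbT/=.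
case: (ltgtP u V.2) ut => // ut _.
  by rewrite addr0; apply: tame_square => //; lra.
have -> : beta u V.2 = beta V.2 u by case: hbeta => _ _; apply; apply/andP; split; lra.
by rewrite add0r; apply: tame_square => //; lra.
Qed.

Let measurable_near V : measurable_fun setT (near_cost V).
Proof.
by apply: measurable_funD; apply/(measurable_restrictT _ (measurable_itv _));
  apply: measurable_funTS; apply: measurable_powR_comp; exact: measurable_funB.
Qed.

(** Each side of the pivot contributes at most [2 c^2] times the square root of the interval length,
    which is [root4 V.1 ^+ 2]. *)
Lemma integral_cost_square V :
  (\int[uniform01 R]_u (cost V u ^+ 2)%:E <=
   (4 * c ^+ 2 * root4 V.1 ^+ 2 * (pivot V)%:R)%:E)%E.
Proof.
have [pV|npV] := boolP (pivot V); last first.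
  rewrite mulr0 integral0_eq// => u _; by rewrite cost_npivot// expr0n.
have mc := measurable_cost2 V.
have mn := measurable_near V.
have mcn : measurable_fun setT (fun u => c ^+ 2 * near_cost V u) by exact: measurable_funM.
rewrite ge0_integral_uniform01//; last 2 first.
- by apply/measurable_EFinP; exact: measurable_funX.
- by move=> u; rewrite lee_fin sqr_ge0.
have [l0 r1 lt tr] := and4P pV.
apply: (@le_trans _ _ (\int[leb]_(u in `[0%R, 1%R]) (c ^+ 2 * near_cost V u)%:E)%E).
  apply: ae_ge0_le_integral => //.
  - by move=> u _; rewrite lee_fin sqr_ge0.
  - by apply: measurable_funTS; apply/measurable_EFinP; exact: measurable_funX.
  - by move=> u _; rewrite lee_fin mulr_ge0 ?sqr_ge0.
  - by apply: measurable_funTS; apply/measurable_EFinP.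
  (* Tameness says nothing on the diagonal, but a single point is negligible. *)
  - exists [set V.2]; split => [//||u /=]; first exact: lebesgue_measure_set1.
    move=> h; apply/eqP; apply/negPn/negP => /cost_square_near ut.
    by apply: h => _; rewrite lee_fin.
apply: (@le_trans _ _ (\int[leb]_u (c ^+ 2 * near_cost V u)%:E)%E).
  apply: ge0_subset_integral => //.
  - exact/measurable_EFinP.
  - by move=> u _; rewrite lee_fin mulr_ge0 ?sqr_ge0.
under eq_integral do rewrite EFinM.
rewrite ge0_integralZl//; last 3 first.
- exact/measurable_EFinP.
- by move=> u _; rewrite lee_fin.
- by rewrite lee_fin sqr_ge0.
under eq_integral do rewrite EFinD.
rewrite ge0_integralD//; last 4 first.
- by move=> u _; rewrite lee_fin patchE; case: ifP => _ //; exact: powR_ge0.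
- apply/measurable_EFinP; apply/(measurable_restrictT _ (measurable_itv _)).
  by apply: measurable_funTS; apply: measurable_powR_comp; exact: measurable_funB.
- by move=> u _; rewrite lee_fin patchE; case: ifP => _ //; exact: powR_ge0.
- apply/measurable_EFinP; apply/(measurable_restrictT _ (measurable_itv _)).
  by apply: measurable_funTS; apply: measurable_powR_comp; exact: measurable_funB.
have rE (D : set R) (f : R -> R) :
    (\int[leb]_u ((f \_ D) u)%:E = \int[leb]_(u in D) (f u)%:E)%E.
  by rewrite [RHS]integral_mkcond; apply: eq_integral => u _; rewrite !patchE; case: ifP.
rewrite !rE.
have sq : (V.2 - V.1.1) `^ 2^-1 <= (V.1.2 - V.1.1) `^ 2^-1 /\
          (V.1.2 - V.2) `^ 2^-1 <= (V.1.2 - V.1.1) `^ 2^-1.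
  by split; apply: ge0_ler_powR; rewrite ?nnegrE; lra.
apply: (@le_trans _ _ ((c ^+ 2)%:E *
   ((2 * (V.2 - V.1.1) `^ 2^-1)%:E + (2 * (V.1.2 - V.2) `^ 2^-1)%:E))%E).
  apply: lee_wpmul2l; first by rewrite lee_fin sqr_ge0.
  by apply: leeD; [exact: integral_invsqrt_left|exact: integral_invsqrt_right].
rewrite root4_pow2 -EFinD -EFinM lee_fin mulr1.
have -> : 4 * c ^+ 2 * (V.1.2 - V.1.1) `^ 2^-1 = c ^+ 2 * (4 * (V.1.2 - V.1.1) `^ 2^-1) by ring.
rewrite ler_pM2l ?exprn_gt0//; lra.
Qed.

(** The inequality [x <= x^2 / s + s], with [s] the fourth root of the length, reduces the first
    moment to the second. *)
Lemma integral_cost V : (\int[uniform01 R]_u (cost V u)%:E <=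
  ((4 * c ^+ 2 + 1) * root4 V.1 * (pivot V)%:R)%:E)%E.
Proof.
have [pV|npV] := boolP (pivot V); last first.
  by rewrite mulr0 integral0_eq// => u _; rewrite cost_npivot.
have mc := measurable_cost2 V.
have [l0 r1 lt tr] := and4P pV.
set s := root4 V.1.
have s0 : 0 < s by apply: powR_gt0; lra.
apply: (@le_trans _ _ (\int[uniform01 R]_u ((s^-1)%:E * (cost V u ^+ 2)%:E + s%:E))%E).
  apply: ge0_le_integral => //.
  - by move=> u _; rewrite lee_fin cost_ge0.
  - exact/measurable_EFinP.
  - apply: emeasurable_funD => //; apply: measurable_funeM.
    by apply/measurable_EFinP; exact: measurable_funX.
  move=> u _; rewrite -EFinM -EFinD lee_fin.
  have x0 := cost_ge0 V u; set x := cost V u in x0 *.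
  rewrite -(ler_pM2l s0) mulrDr mulrA mulfV ?gt_eqF// mul1r -subr_ge0.
  have -> : x ^+ 2 + s * s - s * x = (x - s) ^+ 2 + s * x by ring.
  by rewrite addr_ge0 ?sqr_ge0 ?mulr_ge0// ltW.
rewrite ge0_integralD//; last 3 first.
- by move=> u _; rewrite -EFinM lee_fin mulr_ge0 ?sqr_ge0 ?invr_ge0// ltW.
- by apply: measurable_funeM; apply/measurable_EFinP; exact: measurable_funX.
- by move=> u _; rewrite lee_fin ltW.
rewrite ge0_integralZl//; last 3 first.
- by apply/measurable_EFinP; exact: measurable_funX.
- by move=> u _; rewrite lee_fin sqr_ge0.
- by rewrite lee_fin invr_ge0 ltW.
rewrite integral_uniform01_cst.
apply: (@le_trans _ _ ((s^-1)%:E * (4 * c ^+ 2 * s ^+ 2)%:E + s%:E)%E).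
  apply: leeD => //; apply: lee_wpmul2l; first by rewrite lee_fin invr_ge0 ltW.
  by have := integral_cost_square V; rewrite pV mulr1.
rewrite -EFinM -EFinD lee_fin mulr1 le_eqVlt; apply/orP; left; apply/eqP.
by field; rewrite gt_eqF.
Qed.

Lemma mean_costE V : ((mean_cost V)%:E = \int[uniform01 R]_u (cost V u)%:E)%E.
Proof.
rewrite fineK// ge0_fin_numE; first exact: (le_lt_trans (integral_cost V) (ltry _)).
by apply: integral_ge0 => u _; rewrite lee_fin cost_ge0.
Qed.

Lemma mean_cost_ge0 V : 0 <= mean_cost V.
Proof. by apply: fine_ge0; apply: integral_ge0 => u _; rewrite lee_fin cost_ge0. Qed.

Lemma mean_cost_le V : mean_cost V <= (4 * c ^+ 2 + 1) * root4 V.1 * (pivot V)%:R.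
Proof. by rewrite -lee_fin mean_costE integral_cost. Qed.

Lemma mean_cost_lebesgue V : pivot V ->
  (\int[leb]_(x in `]V.1.1, V.1.2[) (beta x V.2)%:E = (mean_cost V)%:E)%E.
Proof.
move=> pV; have [l0 r1 lt tr] := and4P pV.
rewrite mean_costE ge0_integral_uniform01//; last 2 first.
- by apply/measurable_EFinP; exact: measurable_cost2.
- by move=> u; rewrite lee_fin cost_ge0.
rewrite integral_mkcond [RHS]integral_mkcond; apply: eq_integral => u _.
rewrite !patchE !mem_setE !in_itv/= /cost pV/=.
case: ifP => [/andP[lu ur]|_]; last by rewrite if_same.
rewrite ifT//; apply/andP; split; lra.
Qed.

Lemma integral_deviation V (D k : R) : 0 <= k ->
  (\int[uniform01 R]_u ((D + (cost V u - mean_cost V)) ^+ 2 * k)%:E <=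
   (D ^+ 2 * k)%:E + (4 * c ^+ 2 * root4 V.1 ^+ 2 * (pivot V)%:R * k)%:E)%E.
Proof.
move=> k0; have mc := measurable_cost2 V.
set g := mean_cost V; set Q := uniform01 R.
have mc2 : measurable_fun setT (fun u => cost V u ^+ 2) by exact: measurable_funX.
have i1 : Q.-integrable setT (fun u => (cost V u)%:E).
  apply/integrableP; split; first exact/measurable_EFinP.
  under eq_integral do rewrite gee0_abs ?lee_fin ?cost_ge0//.
  exact: (le_lt_trans (integral_cost V) (ltry _)).
have i2 : Q.-integrable setT (fun u => (cost V u ^+ 2)%:E).
  apply/integrableP; split; first exact/measurable_EFinP.
  under eq_integral do rewrite gee0_abs ?lee_fin ?sqr_ge0//.
  exact: (le_lt_trans (integral_cost_square V) (ltry _)).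
have i0 (r : R) : Q.-integrable setT (cst r%:E).
  exact: (finite_measure_integrable_cst Q r measurableT).
have E u : ((D + (cost V u - g)) ^+ 2 * k)%:E =
   (((D - g) ^+ 2 * k)%:E + ((2 * (D - g) * k)%:E * (cost V u)%:E + k%:E * (cost V u ^+ 2)%:E))%E.
  by rewrite -!EFinM -!EFinD; congr EFin; ring.
under eq_integral do rewrite E.
have i3 : Q.-integrable setT (fun u => (2 * (D - g) * k)%:E * (cost V u)%:E)%E.
  exact: integrableZl.
have i4 : Q.-integrable setT (fun u => k%:E * (cost V u ^+ 2)%:E)%E.
  exact: integrableZl.
rewrite integralD//; [|exact: i0|exact: integrableD].
rewrite integralD// !integralZl// integral_uniform01_cst -mean_costE -/g.
apply: (@le_trans _ _ (((D - g) ^+ 2 * k)%:E + ((2 * (D - g) * k)%:E * g%:E +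
   k%:E * (4 * c ^+ 2 * root4 V.1 ^+ 2 * (pivot V)%:R)%:E))%E).
  apply: leeD => //; apply: leeD => //; apply: lee_wpmul2l; first by rewrite lee_fin.
  exact: integral_cost_square.
rewrite -!EFinM -!EFinD lee_fin -subr_ge0.
set z := 4 * c ^+ 2 * _ * _.
have -> : D ^+ 2 * k + z * k - ((D - g) ^+ 2 * k + (2 * (D - g) * k * g + k * z)) =
  g ^+ 2 * k by ring.
by rewrite mulr_ge0 ?sqr_ge0//.
Qed.

End comparison_cost.

(** * Moments *)

Section series_lemmas.
Context (R : realType).
Local Open Scope ereal_scope.

Lemma nneseries_le_bound (u : (\bar R)^nat) (K : \bar R) : (forall n, 0 <= u n) ->
  (forall N, \sum_(0 <= i < N) u i <= K) -> \sum_(i <oo) u i <= K.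
Proof.
by move=> u0 uK; apply: lime_le; [exact: is_cvg_nneseries|exact: nearW].
Qed.

(** Telescoping: the sum of [1 / n^2] for [1 <= n <= N] is at most [2 - 1 / N]. *)
Lemma nneseries_inv_square (C : R) : (0 <= C)%R ->
  \sum_(n <oo) (C / n.+1%:R ^+ 2)%:E <= (2 * C)%:E.
Proof.
move=> C0; apply: nneseries_le_bound => [n|N].
  by rewrite lee_fin divr_ge0.
suff: \sum_(0 <= i < N) (C / i.+1%:R ^+ 2)%:E <= (C * (2 - N%:R^-1))%:E.
  move=> /le_trans; apply; rewrite lee_fin mulrC ler_wpM2r// lerBlDr lerDl.
  by rewrite invr_ge0.
case: N => [|N]; first by rewrite big_geq// lee_fin mulr_ge0// invr0 subr0.
elim: N => [|N IH]; first by rewrite big_nat1 lee_fin expr1n !invr1; lra.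
rewrite big_nat_recr//=; apply: (le_trans (leeD IH (le_refl _))).
rewrite -EFinD lee_fin -mulrDr ler_wpM2l//.
rewrite -addrA lerD2l -lerBrDl lerBrDl -subr_ge0.
have a0 : (0 < N.+1%:R :> R)%R by [].
have -> : (N.+2%:R = N.+1%:R + 1 :> R)%R by rewrite -natr1.
set x : R := N.+1%:R in a0 *.
have -> : (- (x + 1)^-1 - (- x^-1 + (x + 1) ^- 2) = (x * (x + 1) ^+ 2)^-1)%R.
  by field; rewrite !gt_eqF//; lra.
by rewrite invr_ge0 mulr_ge0 ?sqr_ge0// ltW.
Qed.

(** By Tonelli the sum has a finite integral, hence is finite almost everywhere. *)
Lemma ae_nneseries_lty d (T : measurableType d) (mu : {measure set T -> \bar R})
    (f : nat -> T -> \bar R) :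
  (forall n, measurable_fun setT (f n)) -> (forall n x, 0 <= f n x) ->
  \sum_(n <oo) \int[mu]_x f n x < +oo ->
  {ae mu, forall x, \sum_(n <oo) f n x < +oo}.
Proof.
move=> mf f0 foo.
have mS : measurable_fun setT (fun x => \sum_(n <oo) f n x).
  exact: ge0_emeasurable_sum.
have iS : mu.-integrable setT (fun x => \sum_(n <oo) f n x).
  apply/integrableP; split => //.
  under eq_integral do rewrite gee0_abs ?nneseries_ge0//.
  by rewrite integral_nneseries.
have := integrable_ae measurableT iS; apply: filterS => x /(_ I).
by rewrite ge0_fin_numE// nneseries_ge0.
Qed.

End series_lemmas.

(** * The interval alive before each seed *)

Section live_interval.
Context (R : realType) (alpha : R).

(* Indexed by the number [m] of seeds read so far, whereas [bounds] counts the pivots. *)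
Fixpoint live (u : nat -> R) (m : nat) : R * R :=
  if m is m'.+1 then shrink alpha (live u m') (u m') else (0, 1).

Lemma live_valid u m : 0 <= alpha <= 1 -> valid alpha (live u m).
Proof.
move=> /andP[a0 a1]; elim: m => [|m IH] /=; last exact: shrink_valid.
by split.
Qed.

(** Only a candidate: [pivot] decides whether the seed [j] falls in its interval. *)
Definition pivot_at (u : nat -> R) (j : nat) : (R * R) * R := (live u j, u j).

Definition deviation (beta : R -> R -> R) (u : nat -> R) (j n : nat) : R :=
  \sum_(j.+1 <= i < n) (cost beta (pivot_at u j) (u i) - mean_cost beta (pivot_at u j)).

(* The reciprocal of [root4] (and [0] if [root4] is [0]), in a form whose
   measurability is in the library. *)
Definition weight (V : (R * R) * R) : R := (V.1.2 - V.1.1) `^ (- 4^-1).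

Lemma weightE V : weight V = (root4 V.1)^-1.
Proof. by rewrite /weight powRN. Qed.

Lemma weight_ge0 V : 0 <= weight V.
Proof. exact: powR_ge0. Qed.

Lemma measurable_weight : measurable_fun setT weight.
Proof.
apply: measurable_powR_comp; apply: measurable_funB.
  exact: (measurableT_comp measurable_snd measurable_fst).
exact: (measurableT_comp measurable_fst measurable_fst).
Qed.

End live_interval.

(** * Expectations along the interval process *)

Section expectations.
Context d (T : measurableType d) (R : realType) (P : probability T R).
Variables (alpha eps c : R) (beta : R -> R -> R) (U : nat -> {RV P >-> R}).
Hypothesis halpha : 0 <= alpha <= 1.
Hypothesis hbeta : cost_function beta.
Hypotheses (heps4 : eps < 1 / 4) (c0 : 0 < c).
Hypothesis hc : forall u t, 0 < u -> u < t -> t < 1 -> beta u t <= c * (t - u) `^ (- eps).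
Hypothesis hU : iid_uniform01 U.

Let u (w : T) (i : nat) : R := U i w.
Let L m w := live alpha (u w) m.
Let s m w : R := root4 (L m w).
Let V m w := pivot_at alpha (u w) m.

(** The interval [L m] uses the seeds before [m] only, so [U m] is independent of it; the candidate
    [V m] contains that seed, whence the index [m.+1] below. *)
Let adapted_L m : adapted U m (L m).
Proof.
elim: m => [|m IH]; first exact: measurable_cst.
exact: (adapted_comp (measurable_shrink alpha)
  (adapted_pair (adapted_le (leqnSn m) IH) (@adapted_seed _ _ _ _ U m))).
Qed.

Let adapted_V m : adapted U m.+1 (V m).
Proof.
have h : adapted U m.+1 (fun w => (L m w, U m w)).
  have h1 := adapted_le (leqnSn m) (@adapted_L m).
  have h2 := @adapted_seed _ _ _ _ U m.
  have h3 := adapted_pair h1 h2; exact: h3.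
exact: h.
Qed.

Let valid_L m w : valid alpha (L m w).
Proof. exact: live_valid. Qed.

Let ms m : measurable_fun setT (s m).
Proof. exact: (measurableT_comp (@measurable_root4 R) (adapted_measurable (@adapted_L m))). Qed.

Let s_ge0 m w : 0 <= s m w. Proof. exact: root4_ge0. Qed.

Local Open Scope ereal_scope.

(** [shrink_gain] is integrated, and [freezing] replaces the gain by its mean over a fresh seed,
    which [integral_gain] bounds below. *)
Let integral_s_step m :
  \int[P]_w (s m.+1 w)%:E + (32^-1)%:E * \int[P]_w (s m w ^+ 5)%:E <= \int[P]_w (s m w)%:E.
Proof.
(* [freezing] wants nonnegativity at every state; on valid states the absolute value changes
   nothing. *)
have mg : measurable_fun setT (fun x : (R * R) * R => `|gain alpha x.1 x.2|%R).
  by apply: measurableT_comp => //; exact: measurable_gain.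
have mLU : measurable_fun setT (fun w => (L m w, u w m)).
  apply: measurable_fun_pair; last exact: measurable_funPT.
  exact: adapted_measurable (@adapted_L m).
have mgLU : measurable_fun setT (fun w => `|gain alpha (L m w) (u w m)|%R).
  exact: (measurableT_comp mg mLU).
have ms5 : measurable_fun setT (fun w => (s m w ^+ 5)%:E).
  by apply/measurable_EFinP; exact: measurable_funX.
apply: (@le_trans _ _ (\int[P]_w (s m.+1 w)%:E +
    \int[P]_w (`|gain alpha (L m w) (u w m)|%R)%:E)).
  apply: leeD => //.
  rewrite [leRHS](freezing hU (f := fun x => (`|gain alpha x.1 x.2|%R)%:E) (@adapted_L m))//.
    rewrite -ge0_integralZl//.
      apply: ge0_le_integral => //.
      - by move=> w _; rewrite -EFinM lee_fin mulr_ge0 ?exprn_ge0.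
      - exact: measurable_funeM.
      - have mF : measurable_fun setT
            (fubini_F (uniform01 R) (fun x => (`|gain alpha x.1 x.2|%R)%:E)).
          apply: measurable_fun_fubini_tonelli_F => [|x].
            by apply/measurable_EFinP.
          by rewrite lee_fin.
        exact: (measurableT_comp mF (adapted_measurable (@adapted_L m))).
      - move=> w _ /=; rewrite -EFinM.
        under eq_integral do rewrite ger0_norm ?gain_ge0//.
        exact: integral_gain.
    by move=> w _; rewrite lee_fin exprn_ge0.
  by apply/measurable_EFinP.
rewrite -ge0_integralD//; last 3 first.
- by move=> w _; rewrite lee_fin.
- exact/measurable_EFinP.
- exact/measurable_EFinP.
apply: ge0_le_integral => //.
- by move=> w _; rewrite -EFinD lee_fin addr_ge0.
- by apply: emeasurable_funD; apply/measurable_EFinP.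
- exact/measurable_EFinP.
- move=> w _; rewrite -EFinD lee_fin ger0_norm; last exact: gain_ge0 (valid_L m w).
  exact: (shrink_gain (u w m) (valid_L m w)).
Qed.

(** Telescoping of [integral_s_step], starting from [s 0 <= 1]. *)
Lemma sum_integral_root4 : \sum_(m <oo) \int[P]_w (s m w ^+ 5)%:E <= 32%:E.
Proof.
have i0 m : 0 <= \int[P]_w (s m w ^+ 5)%:E.
  by apply: integral_ge0 => w _; rewrite lee_fin exprn_ge0.
apply: nneseries_le_bound => // N.
have : \int[P]_w (s N w)%:E +
    \sum_(0 <= i < N) ((32^-1)%:E * \int[P]_w (s i w ^+ 5)%:E) <= 1.
  elim: N => [|N IH].
    rewrite big_geq// adde0.
    apply: (@le_trans _ _ (\int[P]_w (cst 1 w))).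
      apply: ge0_le_integral => //.
      - by move=> w _; rewrite lee_fin.
      - exact/measurable_EFinP.
      - by move=> w _; rewrite lee_fin; exact: (root4_le1 (valid_L 0 w)).
    have P1 : P setT = 1 by exact: probability_setT.
    by rewrite (integral_cst P measurableT 1) [X in (_ * X)%E]P1 mule1.
  rewrite big_nat_recr//= addeCA addeC; apply: le_trans IH.
  by rewrite addeC [leRHS]addeC leeD2l// integral_s_step.
rewrite -ge0_sume_distrr//.
set S := \sum_(_ <= _ < _) _.
have S0 : 0 <= S by exact: sume_ge0.
move=> h; have : (32^-1)%:E * S <= 1.
  by apply: le_trans h; rewrite leeDr//; apply: integral_ge0 => w _; rewrite lee_fin.
move=> /(lee_wpmul2l (x := 32%:E)); rewrite lee_fin => /(_ (ler0n _ _)).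
by rewrite muleA -EFinM mulfV// mul1e mule1.
Qed.

Let mpivotV m : measurable_fun setT (fun w => pivot (V m w)).
Proof. exact: (measurableT_comp (@measurable_pivot R) (adapted_measurable (@adapted_V m))). Qed.

Let mbool (f : T -> bool) : measurable_fun setT f ->
  measurable_fun setT (fun w => (f w)%:R : R).
Proof.
move=> mf; rewrite (_ : (fun w => _) = (fun w => if f w then 1%R else 0%R)).
  by apply: measurable_fun_ifT.
by apply/funext => w; case: (f w).
Qed.

Let ms_pivot m : measurable_fun setT (fun w => s m w * (pivot (V m w))%:R)%R.
Proof. by apply: measurable_funM => //; exact: mbool. Qed.

(** Given the past, the seed [m] is a pivot with probability the interval length, the fourth power
    of [s m]. *)
Lemma integral_root4_pivot m :
  \int[P]_w (s m w * (pivot (V m w))%:R)%:E <= \int[P]_w (s m w ^+ 5)%:E.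
Proof.
have mf : measurable_fun setT (fun x : (R * R) * R => (root4 x.1 * (pivot x)%:R)%:E).
  apply/measurable_EFinP; apply: measurable_funM.
    exact: (measurableT_comp (@measurable_root4 R) measurable_fst).
  rewrite (_ : (fun x => _) = (fun x : (R * R) * R => if pivot x then 1%R else 0%R)).
    by apply: measurable_fun_ifT => //; exact: measurable_pivot.
  by apply/funext => x; case: (pivot x).
have f0 x : 0 <= (root4 x.1 * (pivot (x : (R * R) * R))%:R)%:E.
  by rewrite lee_fin mulr_ge0 ?root4_ge0.
rewrite (freezing hU (f := fun x => (root4 x.1 * (pivot x)%:R)%:E) (@adapted_L m))//.
apply: ge0_le_integral => //.
- by move=> w _; apply: integral_ge0 => t _; exact: f0.
- have mF : measurable_fun setT (fubini_F (uniform01 R)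
      (fun x => (root4 x.1 * (pivot (x : (R * R) * R))%:R)%:E)).
    exact: measurable_fun_fubini_tonelli_F.
  exact: (measurableT_comp mF (adapted_measurable (@adapted_L m))).
- by apply/measurable_EFinP; exact: measurable_funX.
move=> w _ /=; set st := L m w.
have vst : valid alpha st by exact: valid_L.
have lr := valid_le vst; have [l0 la ar r1] := vst.
pose J := `]st.1, st.2[%classic : set R.
have mJ : measurable J by exact: measurable_itv.
under eq_integral => t _.
  rewrite (_ : (root4 st * (pivot (st, t))%:R)%:E = (root4 st)%:E * (\1_J t)%:E); last first.
    by rewrite -EFinM /J indicE mem_setE in_itv/= /pivot/= l0 r1.
  over.
have mi : measurable_fun (setT : set R) (fun t => (\1_J t)%:E : \bar R).
  by apply/measurable_EFinP; exact: measurable_indic.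
rewrite ge0_integralZl//; last by rewrite lee_fin root4_ge0.
rewrite ge0_integral_uniform01// integral_indic// setIidl; last first.
  by move=> t; rewrite /J /= !in_itv/= => /andP[? ?]; apply/andP; split; lra.
rewrite /J /= lebesgue_measure_itv/= lte_fin exprS root4_pow4//.
rewrite EFinM; apply: lee_wpmul2l; first by rewrite lee_fin root4_ge0.
by case: ifPn => h; rewrite -?EFinB// lee_fin; lra.
Qed.

Let D j n w := deviation alpha beta (u w) j n.

Let D0 j n w : (n <= j.+1)%N -> D j n w = 0%R.
Proof. by move=> nj; rewrite /D /deviation big_geq. Qed.

Let DS j n w : (j < n)%N ->
  D j n.+1 w = (D j n w + (cost beta (V j w) (u w n) - mean_cost beta (V j w)))%R.
Proof. by move=> jn; rewrite /D /deviation big_nat_recr. Qed.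

(** One martingale step as a function of the past [(V, D)] and of the fresh seed, the form that
    [freezing] takes. *)
Let next (x : (((R * R) * R) * R) * R) : R :=
  (x.1.2 + (cost beta x.1.1 x.2 - mean_cost beta x.1.1))%R.

Let measurable_next : measurable_fun setT next.
Proof.
apply: measurable_funD.
  exact: (measurableT_comp measurable_snd measurable_fst).
have m11 : measurable_fun setT (fun x : (((R * R) * R) * R) * R => x.1.1).
  exact: (measurableT_comp measurable_fst measurable_fst).
apply: measurable_funB.
  have mp : measurable_fun setT (fun x : (((R * R) * R) * R) * R => (x.1.1, x.2)).
    exact: measurable_fun_pair.
  exact: (measurableT_comp (measurable_cost hbeta) mp).
exact: (measurableT_comp (measurable_mean_cost hbeta) m11).
Qed.

Let adapted_VD j n : (j < n)%N -> adapted U n (D j n) ->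
  adapted U n (fun w => (V j w, D j n w)).
Proof.
move=> jn aD; have aV := adapted_le jn (@adapted_V j).
exact: adapted_pair aV aD.
Qed.

Let adapted_D j n : adapted U n (D j n).
Proof.
elim: n => [|n IH].
  rewrite (_ : D j 0%N = cst 0%R); first exact: measurable_cst.
  by apply/funext => w; rewrite D0.
have [jn|nj] := ltnP j n; last first.
  rewrite (_ : D j n.+1 = cst 0%R); first exact: measurable_cst.
  by apply/funext => w; rewrite D0.
rewrite (_ : D j n.+1 = (fun w => next ((V j w, D j n w), U n w))); last first.
  by apply/funext => w; rewrite DS.
have h1 := adapted_le (leqnSn n) (adapted_VD jn IH).
have h2 := @adapted_seed _ _ _ _ U n.
have h3 := adapted_pair h1 h2.
exact: (adapted_comp measurable_next h3).
Qed.

Let mD j n : measurable_fun setT (D j n).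
Proof. exact: adapted_measurable (@adapted_D j n). Qed.

Let mweight j : measurable_fun setT (fun w => weight (V j w)).
Proof. exact: (measurableT_comp (@measurable_weight R) (adapted_measurable (@adapted_V j))). Qed.

(** Induction on [n]: a new seed adds at most [4 c^2 s^2] on the event that [j] is a pivot. The
    weight [1 / s] leaves [s] on that event, whose mean [integral_root4_pivot] bounds. *)
Lemma integral_deviation_sq j n :
  \int[P]_w (D j n w ^+ 2 * weight (V j w))%:E <=
  (n%:R * (4 * c ^+ 2))%:E * \int[P]_w (s j w ^+ 5)%:E.
Proof.
have I0 : 0 <= \int[P]_w (s j w ^+ 5)%:E.
  by apply: integral_ge0 => w _; rewrite lee_fin exprn_ge0.
elim: n => [|n IH].
  by rewrite integral0_eq ?mul0r ?mul0e// => w _; rewrite D0// expr0n mul0r.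
(* For [n <= j] the sum defining [D j n.+1] is empty. *)
have [jn|nj] := ltnP j n; last first.
  rewrite integral0_eq; last by move=> w _; rewrite D0// expr0n mul0r.
  by rewrite mule_ge0// lee_fin mulr_ge0// mulr_ge0// sqr_ge0.
pose f (x : (((R * R) * R) * R) * R) := (next x ^+ 2 * weight x.1.1)%:E.
have mf : measurable_fun setT f.
  apply/measurable_EFinP; apply: measurable_funM; first exact: measurable_funX.
  exact: (measurableT_comp (@measurable_weight R) (measurableT_comp measurable_fst measurable_fst)).
have f0 x : 0 <= f x by rewrite lee_fin mulr_ge0 ?sqr_ge0 ?weight_ge0.
have aVD := adapted_VD jn (@adapted_D j n).
rewrite (_ : \int[P]_w _ = \int[P]_w f ((V j w, D j n w), U n w)); last first.
  by apply: eq_integral => w _; rewrite /f DS.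
rewrite (freezing hU aVD mf f0).
pose K : R := (4 * c ^+ 2)%R.
have K0 : (0 <= K)%R by rewrite mulr_ge0 ?sqr_ge0.
apply: (@le_trans _ _ (\int[P]_w ((D j n w ^+ 2 * weight (V j w))%:E +
    K%:E * (s j w * (pivot (V j w))%:R)%:E))).
  apply: ge0_le_integral => //.
  - by move=> w _; apply: integral_ge0 => t _; exact: f0.
  - have mF : measurable_fun setT (fubini_F (uniform01 R) f).
      exact: measurable_fun_fubini_tonelli_F.
    exact: (measurableT_comp mF (adapted_measurable aVD)).
  - apply: emeasurable_funD.
      by apply/measurable_EFinP; apply: measurable_funM => //; exact: measurable_funX.
    by apply: measurable_funeM; apply/measurable_EFinP.
  move=> w _ /=; rewrite /f /next /=.
  apply: (le_trans (integral_deviation hbeta heps4 c0 hc (V j w) (D j n w) (weight_ge0 _))).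
  apply: leeD => //; rewrite -EFinM lee_fin weightE /s /K.
  have -> : root4 (V j w).1 = root4 (L j w) by [].
  set x := root4 (L j w).
  have [->|x0] := eqVneq x 0%R; first by rewrite expr0n !(mulr0, mul0r).
  by rewrite le_eqVlt; apply/orP; left; apply/eqP; field.
rewrite ge0_integralD//; last 4 first.
- by move=> w _; rewrite lee_fin mulr_ge0 ?sqr_ge0 ?weight_ge0.
- by apply/measurable_EFinP; apply: measurable_funM => //; exact: measurable_funX.
- by move=> w _; rewrite mule_ge0// lee_fin ?mulr_ge0//.
- by apply: measurable_funeM; apply/measurable_EFinP.
rewrite ge0_integralZl//; last 2 first.
- exact/measurable_EFinP.
- by move=> w _; rewrite lee_fin mulr_ge0.
apply: (le_trans (leeD IH (lee_wpmul2l _ (integral_root4_pivot j)))); first by rewrite lee_fin.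
rewrite -/K -ge0_muleDl ?lee_fin ?(mulr_ge0 _ K0)//.
by rewrite -EFinD -[X in (_ + X)%R]mul1r -mulrDl natr1.
Qed.

Let q j n w : \bar R :=
  ((D j (n.+1 ^ 2) w / (n.+1 ^ 2)%:R) ^+ 2 * weight (V j w))%:E.

Let q0 j n w : 0 <= q j n w.
Proof. by rewrite lee_fin mulr_ge0 ?sqr_ge0 ?weight_ge0. Qed.

Let mq j n : measurable_fun setT (q j n).
Proof.
apply/measurable_EFinP; apply: measurable_funM => //; apply: measurable_funX.
by apply: measurable_funM => //; exact: mD.
Qed.

(** With [N = (n + 1)^2], the mean of [q j n] is at most [4 c^2 / N] times that of [s j ^+ 5]. Along
    squares this is summable in [n], and [sum_integral_root4] handles the sum over [j]. *)
Lemma ae_deviation : {ae P, forall w, \sum_(j <oo) \sum_(n <oo) q j n w < +oo}.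
Proof.
apply: ae_nneseries_lty => [j|j w|].
- by apply: ge0_emeasurable_sum => n *; [exact: q0|exact: mq].
- exact: nneseries_ge0.
pose K : R := (4 * c ^+ 2)%R.
have K0 : (0 <= K)%R by rewrite mulr_ge0 ?sqr_ge0.
pose e j := \int[P]_w (s j w ^+ 5)%:E.
have e0 j : 0 <= e j by apply: integral_ge0 => w _; rewrite lee_fin exprn_ge0.
apply: (@le_lt_trans _ _ (\sum_(j <oo) (2 * K)%:E * e j)).
  apply: lee_nneseries => [j _ _|j _].
    by apply: integral_ge0 => w _; exact: nneseries_ge0.
  rewrite integral_nneseries//.
  apply: (@le_trans _ _ (\sum_(n <oo) (K / n.+1%:R ^+ 2)%:E * e j)).
    apply: lee_nneseries => [n _ _|n _].
      by apply: integral_ge0 => w _; exact: q0.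
    set N := (n.+1 ^ 2)%N.
    have N0 : (0 < N%:R :> R)%R by rewrite ltr0n expn_gt0.
    rewrite (_ : \int[P]_w _ = (N%:R ^- 2)%:E * \int[P]_w (D j N w ^+ 2 * weight (V j w))%:E).
      apply: (le_trans (lee_wpmul2l _ (integral_deviation_sq j N))).
        by rewrite lee_fin invr_ge0 sqr_ge0.
      rewrite muleA -EFinM -[(n.+1%:R ^+ 2)%R]natrX -/N -/K le_eqVlt; apply/orP; left.
      apply/eqP; congr (_%:E * _)%E; move: (N%:R : R)%R N0 => x x0.
      by field; rewrite gt_eqF.
    rewrite -ge0_integralZl//.
    - apply: eq_integral => w _; rewrite /q -/N -EFinM; congr EFin.
      by rewrite exprMn exprVn mulrAC [RHS]mulrC.
    - by apply/measurable_EFinP; apply: measurable_funM => //; exact: measurable_funX.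
    - by move=> w _; rewrite lee_fin mulr_ge0 ?sqr_ge0 ?weight_ge0.
  have ef : e j \is a fin_num.
    rewrite ge0_fin_numE//; apply: le_lt_trans (ltry 32).
    apply: le_trans sum_integral_root4.
    have := @nneseries_lim_ge R e xpredT 0 j.+1 (fun n _ _ => e0 n).
    by apply: le_trans; rewrite big_nat_recr//= leeDr// sume_ge0.
  rewrite -(fineK ef); under eq_eseriesr do rewrite muleC.
  rewrite nneseriesZl; last by move=> n _; rewrite lee_fin divr_ge0.
  by rewrite muleC lee_wpmul2r ?lee_fin ?fine_ge0//; exact: nneseries_inv_square.
rewrite nneseriesZl//.
apply: (@le_lt_trans _ _ ((2 * K)%:E * 32%:E)); last by rewrite -EFinM ltry.
by apply: lee_wpmul2l; [rewrite lee_fin mulr_ge0|exact: sum_integral_root4].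
Qed.

Lemma ae_root4_pivot :
  {ae P, forall w, \sum_(j <oo) (s j w * (pivot (V j w))%:R)%:E < +oo}.
Proof.
apply: ae_nneseries_lty => [j|j w|].
- exact/measurable_EFinP.
- by rewrite lee_fin mulr_ge0.
apply: le_lt_trans (ltry 32); apply: le_trans sum_integral_root4.
apply: lee_nneseries => [j _ _|j _]; last exact: integral_root4_pivot.
by apply: integral_ge0 => w _; rewrite lee_fin mulr_ge0.
Qed.

(** This forces the interval lengths to tend to [0], which later guarantees that a next pivot always
    exists. *)
Lemma ae_root4 : {ae P, forall w, \sum_(j <oo) (s j w ^+ 5)%:E < +oo}.
Proof.
apply: ae_nneseries_lty => [j|j w|].
- by apply/measurable_EFinP; exact: measurable_funX.
- by rewrite lee_fin exprn_ge0.
exact: le_lt_trans sum_integral_root4 (ltry _).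
Qed.

(** The uniform law has no atoms. The case of interest is [a = alpha], where [bounds] and [shrink]
    can differ. *)
Lemma ae_seed_neq (a : R) : {ae P, forall w i, u w i != a}.
Proof.
apply/ae_foralln => i; exists (U i @^-1` [set a]); split.
- by rewrite -[X in measurable X]setTI; exact: measurable_funPT.
- have [_ dU] := hU; transitivity (distribution P (U i) [set a]) => //.
  by rewrite dU; [rewrite /uniform_prob integral_set1|exact: measurable_set1].
- by move=> w /negP; rewrite negbK => /eqP.
Qed.

End expectations.

(** * Averages along squares *)

Section averages_along_squares.
Context (R : realType).

Lemma square_bracket : exists p : nat -> nat,
  forall n, (0 < n)%N -> ((p n).+1 ^ 2 <= n < (p n).+2 ^ 2)%N.
Proof.
suff /choice[p pP] : forall n, exists p, (0 < n)%N -> (p.+1 ^ 2 <= n < p.+2 ^ 2)%N.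
  by exists p.
elim=> [|[_|n [p /(_ isT)/andP[p1 p2]]]]; first by exists 0%N.
  by exists 0%N.
have [h|h] := ltnP n.+2 (p.+2 ^ 2).
  by exists p => _; rewrite h (leq_trans p1).
exists p.+1 => _; rewrite h /=; apply: (leq_ltn_trans p2).
by rewrite ltn_exp2r.
Qed.

Variables (H : nat -> R).
Hypothesis H0 : forall n, 0 <= H n.
Hypothesis ndH : {homo H : m n / (m <= n)%N >-> m <= n}.

Let a n : R := H (n.+1 ^ 2)%N / (n.+1 ^ 2)%:R.

Let ratio (p : nat) : R := p.+2%:R / p.+1%:R.

(** [H] is monotone between the two squares around [n]; exchanging their denominators costs a factor
    [ratio p ^+ 2], which tends to [1]. *)
Let bracket (p n : nat) : (p.+1 ^ 2 <= n < p.+2 ^ 2)%N ->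
  a p * (ratio p) ^- 2 <= H n / n%:R <= a p.+1 * ratio p ^+ 2.
Proof.
move=> /andP[pn np]; have n0 : (0 < n)%N by apply: leq_trans pn; rewrite expn_gt0.
have nR0 : 0 < n%:R :> R by rewrite ltr0n.
have p1 : 0 < p.+1%:R :> R by rewrite ltr0n.
have p2 : 0 < p.+2%:R :> R by rewrite ltr0n.
have -> : a p * ratio p ^- 2 = H (p.+1 ^ 2)%N / p.+2%:R ^+ 2.
  by rewrite /a /ratio natrX; field; rewrite !gt_eqF.
have -> : a p.+1 * ratio p ^+ 2 = H (p.+2 ^ 2)%N / p.+1%:R ^+ 2.
  by rewrite /a /ratio natrX; field; rewrite !gt_eqF.
apply/andP; split.
  apply: ler_pM => //; first exact: ndH.
  by rewrite lef_pV2 ?posrE ?exprn_gt0// -natrX ler_nat ltnW.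
apply: ler_pM => //; first by apply: ndH; exact: ltnW.
by rewrite lef_pV2 ?posrE ?exprn_gt0// -natrX ler_nat.
Qed.

(** The ratio is at most [2], hence the factor [4]; at [n = 0] the quotient is [0]. *)
Lemma average_le_squares (B : R) : 0 <= B -> (forall n, a n <= B) ->
  forall n, H n / n%:R <= 4 * B.
Proof.
move=> B0 aB [|n]; first by rewrite invr0 mulr0 mulr_ge0.
have [p pP] := square_bracket; have /bracket/andP[_] := pP n.+1 isT.
move=> /le_trans; apply; rewrite mulrC; apply: ler_pM => //.
- exact: sqr_ge0.
- by rewrite divr_ge0.
- rewrite (_ : 4 = 2 ^+ 2); last by rewrite -natrX.
  rewrite lerXn2r ?nnegrE ?divr_ge0//.
  by rewrite ler_pdivrMr ?ltr0n// -natrM ler_nat; lia.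
Qed.

Lemma cvg_average_squares (g : R) :
  a n @[n --> \oo] --> g -> H n / n%:R @[n --> \oo] --> g.
Proof.
move=> ag; have [p pP] := square_bracket.
have p_oo : p n @[n --> \oo] --> \oo.
  apply/cvgnyPge => A; exists (A.+2 ^ 2)%N => // n /= An.
  have n0 : (0 < n)%N by apply: leq_trans An; rewrite expn_gt0.
  have /andP[_ h] := pP n n0; rewrite leqNgt; apply/negP => pA.
  have := leq_ltn_trans An h; rewrite ltn_exp2r// !ltnS; lia.
have ratio1 : ratio n @[n --> \oo] --> (1 : R).
  rewrite (_ : ratio = (fun n => 1 + harmonic n)).
    by rewrite -[X in _ --> X]addr0; apply: cvgD; [exact: cvg_cst|exact: cvg_harmonic].
  apply/funext => n; rewrite /ratio /harmonic/= -[n.+2%:R]natr1; field.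
  by rewrite gt_eqF// ltr0n.
have ratio2 : ratio n ^+ 2 @[n --> \oo] --> (1 : R).
  by rewrite -[X in _ --> X]mulr1; exact: (cvgM ratio1 ratio1).
have low : a n * ratio n ^- 2 @[n --> \oo] --> g.
  have h : (ratio n ^+ 2)^-1 @[n --> \oo] --> (1 : R)^-1.
    by apply: cvgV; [exact: oner_neq0|exact: ratio2].
  have h2 : a n * (ratio n ^+ 2)^-1 @[n --> \oo] --> g * (1 : R)^-1 by exact: cvgM.
  by move: h2; rewrite invr1 mulr1.
have up : a n.+1 * ratio n ^+ 2 @[n --> \oo] --> g.
  have ag1 : a n.+1 @[n --> \oo] --> g by rewrite (cvg_shiftS a).
  have h2 : a n.+1 * ratio n ^+ 2 @[n --> \oo] --> g * 1 by exact: cvgM.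
  by move: h2; rewrite mulr1.
apply: (@squeeze_cvgr _ _ _ _ (fun n => a (p n) * ratio (p n) ^- 2)
   (fun n => a (p n).+1 * ratio (p n) ^+ 2)).
- exists 1%N => // n /= n0; exact/bracket/pP.
- exact: (cvg_comp p _ p_oo low).
- exact: (cvg_comp p _ p_oo up).
Qed.

End averages_along_squares.

(** * Series of nonnegative terms and dominated convergence *)

Section series_of_averages.
Context (R : realType).
Local Open Scope ereal_scope.

Lemma nneseries_cvg0 (x : nat -> R) : (forall n, 0 <= x n)%R ->
  \sum_(n <oo) (x n)%:E < +oo -> x n @[n --> \oo] --> (0 : R)%R.
Proof.
move=> x0 xoo; apply: cvg_series_cvg_0.
apply: (@summable_cvg R xpredT (fun n => (x n)%:E)) => [i _|].
  by rewrite lee_fin.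
rewrite /summable -nneseries_esum//.
by under eq_eseriesr do rewrite gee0_abs ?lee_fin//.
Qed.

Lemma nneseries_term_le (x : nat -> R) (K : R) : (forall n, 0 <= x n)%R ->
  \sum_(n <oo) (x n)%:E <= K%:E -> forall n, (x n <= K)%R.
Proof.
move=> x0 xK n; rewrite -lee_fin; apply: le_trans xK.
have := @nneseries_lim_ge R (fun n => (x n)%:E) xpredT 0 n.+1 (fun n _ _ => x0 n).
apply: le_trans; rewrite big_nat_recr//= leeDr// sume_ge0// => i _.
by rewrite lee_fin.
Qed.

(** This compares a sum over the pivots with the sum over all seeds: the first [N] values of [t] are
    distinct and below [t N]. *)
Lemma nneseries_increasing_le (f : (\bar R)^nat) (t : nat -> nat) :
  (forall n, 0 <= f n) -> (forall k, (t k < t k.+1)%N) ->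
  \sum_(k <oo) f (t k) <= \sum_(j <oo) f j.
Proof.
move=> f0 tk; apply: nneseries_le_bound => // N.
apply: (@le_trans _ _ (\sum_(0 <= j < t N) f j)); last exact: nneseries_lim_ge.
elim: N => [|N IH]; first by rewrite big_geq// sume_ge0.
rewrite big_nat_recr//=; apply: (le_trans (leeD IH (le_refl _))).
rewrite -big_nat_recr//=.
rewrite [leRHS](@big_cat_nat _ _ _ (t N).+1)//=.
by rewrite leeDl// sume_ge0.
Qed.

(** Dominated convergence for the counting measure on the naturals. *)
Lemma nneseries_dominated (a : nat -> nat -> R) (b : nat -> R) (M : (\bar R)^nat) :
  (forall n k, 0 <= a n k)%R -> (forall n k, (a n k)%:E <= M k) ->
  \sum_(k <oo) M k < +oo ->
  (forall k, a n k @[n --> \oo] --> b k) ->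
  \sum_(k <oo) (b k)%:E \is a fin_num /\
  \sum_(k <oo) (a n k)%:E @[n --> \oo] --> \sum_(k <oo) (b k)%:E.
Proof.
move=> a0 aM Moo ab.
have M0 k : 0 <= M k by apply: le_trans (aM 0%N k); rewrite lee_fin.
have b0 k : (0 <= b k)%R.
  by apply: (cvgr_to_ge (ab k)); apply: nearW => n; exact: a0.
have mnat (f : nat -> \bar R) : measurable_fun setT f by move=> _ B mB.
have iM : (@counting nat R).-integrable setT M.
  apply/integrableP; split; first exact: mnat.
  under eq_integral do rewrite gee0_abs//.
  by rewrite ge0_integral_count.
have [] := @dominated_convergence _ nat R (@counting nat R) setT measurableT
  (fun n k => (a n k)%:E) (fun k => (b k)%:E) M (fun n => mnat _) (mnat _).
- by apply: aeW => k _; apply: cvg_EFin; [exact: nearW|exact: ab].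
- exact: iM.
- by apply: aeW => k n _; rewrite gee0_abs; [exact: aM|rewrite lee_fin].
move=> ib _ cb.
split.
  rewrite -ge0_integral_count//.
  exact: integrable_fin_num.
move: cb; rewrite ge0_integral_count//.
rewrite (_ : [sequence _]_n = (fun n => \sum_(k <oo) (a n k)%:E))//.
by apply/funext => n /=; rewrite ge0_integral_count// => k; rewrite lee_fin.
Qed.

End series_of_averages.

(** * Almost sure convergence *)

Lemma nneseries_shift1 (R : realType) (f : (\bar R)^nat) : (forall k, (0 <= f k.+1)%E) ->
  (\sum_(1 <= k <oo) f k = \sum_(k <oo) f k.+1)%E.
Proof.
move=> f0; apply/cvg_lim => //.
rewrite -(cvg_shiftS (fun n => \sum_(1 <= k < n) f k)%E).
rewrite (_ : [sequence _]_n = (fun n => \sum_(0 <= k < n) f k.+1)%E).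
  exact: is_cvg_nneseries.
by apply/funext => n /=; rewrite big_add1.
Qed.

(** * Steps of the algorithm as hits of the live interval *)

Section live_path.
Context (R : realType) (alpha : R) (u : nat -> R).
Hypothesis halpha : 0 <= alpha <= 1.
Local Notation live := (live alpha u).
Local Notation bounds := (bounds alpha u).
Local Notation tau := (tau alpha u).

Let inside (st : R * R) (x : R) := st.1 < x < st.2.

(** A seed once read has either missed the interval or become an endpoint, and intervals are nested.
    So [first_in], which searches from index [0], never returns an old seed. *)
Let live_out i m : (i < m)%N -> ~~ inside (live m) (u i).
Proof.
elim: m => // m IH; rewrite ltnS leq_eqVlt => /predU1P[->|/IH].
  rewrite /= /shrink /inside; case: ifPn => [_|//].
  by case: ifP => _ /=; rewrite ltxx ?andbF.
apply: contra; rewrite /inside /= /shrink; case: ifPn => // /andP[a b].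
by case: ifP => _ /= /andP[h1 h2]; apply/andP; split; lra.
Qed.

Lemma live_lt m : (live m).1 < (live m).2.
Proof.
elim: m => [|m IH] /=; first exact: ltr01.
by rewrite /shrink; case: ifP => // /andP[a b]; case: ifP.
Qed.

Let live_stable m n : (m <= n)%N ->
  (forall i, (m <= i < n)%N -> ~~ inside (live m) (u i)) -> live n = live m.
Proof.
move=> /subnK <-; elim: (n - m)%N => // k IH out.
rewrite addSn /= IH; last first.
  by move=> i /andP[mi ik]; apply: out; rewrite mi addSn ltnS ltnW.
have := out (k + m)%N; rewrite leq_addl addSn ltnSn => /(_ isT).
by rewrite /shrink /inside => /negbTE ->.
Qed.

Hypothesis root4_sum : (\sum_(j <oo) (root4 (live j) ^+ 5)%:E < +oo)%E.

(** Otherwise the interval would stay fixed from [m] on, with positive length, although the terms of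
    the convergent series [root4_sum] tend to [0]. *)
Let live_hit m : exists i, inside (live m) (u i).
Proof.
apply: contrapT => /forallNP h.
have r0 : 0 < root4 (live m) ^+ 5.
  by rewrite exprn_gt0// powR_gt0// subr_gt0 live_lt.
have c0 := nneseries_cvg0 (fun j => exprn_ge0 5 (root4_ge0 (live j))) root4_sum.
have cm : root4 (live n) ^+ 5 @[n --> \oo] --> root4 (live m) ^+ 5.
  apply: cvg_near_cst; exists m => // n /= mn.
  by rewrite (live_stable mn)// => i _; apply/negP/h.
by move: r0; rewrite -(cvg_unique _ c0 cm)// ltxx.
Qed.

Let first_inP m : inside (live m) (u (first_in u (live m).1 (live m).2)) /\
  forall i, inside (live m) (u i) -> (first_in u (live m).1 (live m).2 <= i)%N.
Proof.
rewrite /first_in; case: pselect => [h|]; last by move=> /(_ (live_hit m)).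
by case: ex_minnP => i hi mini; split.
Qed.

Hypothesis u_neq : forall i, u i != alpha.

(** As no seed equals [alpha], exactly one indicator in [bounds] is [1]. The second alternative is
    excluded in [live_first]. *)
Let boundsS k : bounds k.+1 = shrink alpha (bounds k) (u (tau k.+1)) \/
  ~~ inside (bounds k) (u (tau k.+1)).
Proof.
have [hin|] := boolP (inside (bounds k) (u (tau k.+1))); [left|by right].
move: hin; rewrite /= /tau /lo /hi /= /inside /shrink; case: (bounds k) => l r /= ->.
case: ltgtP (u_neq (first_in u l r)) => // pa _.
  by rewrite !mul1r !mul0r !addr0.
by rewrite !mul1r !mul0r !add0r.
Qed.

(** This matches the two clocks, seeds read and pivots found: by minimality of [tau k.+1] no seed
    from [m] up to it hits the interval, which therefore stays unchanged until then. *)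
Let live_first k m : live m = bounds k ->
  [/\ live (tau k.+1) = bounds k, inside (bounds k) (u (tau k.+1)),
      live (tau k.+1).+1 = bounds k.+1 & (m <= tau k.+1)%N].
Proof.
move=> mk; have [hin hmin] := first_inP m.
have tE : tau k.+1 = first_in u (live m).1 (live m).2 by rewrite mk.
rewrite -tE in hin hmin.
have mt : (m <= tau k.+1)%N.
  by rewrite leqNgt; apply/negP => /live_out; rewrite hin.
have lt : live (tau k.+1) = live m.
  apply: live_stable => // i /andP[_ it]; apply/negP => /hmin.
  by rewrite leqNgt it.
rewrite -mk; split => //.
have [->|] := boundsS k; first by rewrite /= lt mk.
by rewrite -mk hin.
Qed.

Let bounds_live k : exists m, live m = bounds k.
Proof.
elim: k => [|k [m mk]]; first by exists 0%N.
by have [_ _ h _] := live_first mk; exists (tau k.+1).+1.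
Qed.

Lemma live_tau k : live (tau k.+1) = bounds k.
Proof. by have [m /live_first[]] := bounds_live k. Qed.

Lemma tau_inside k : (bounds k).1 < u (tau k.+1) < (bounds k).2.
Proof. by have [m /live_first[]] := bounds_live k. Qed.

Lemma tau_lt k : (tau k.+1 < tau k.+2)%N.
Proof. by have [m /live_first[_ _ /live_first[]]] := bounds_live k. Qed.

Lemma pivot_tau k : pivot (pivot_at alpha u (tau k.+1)).
Proof.
have [l0 _ _ r1] := live_valid u (tau k.+1) halpha.
by rewrite /pivot/= l0 r1/= live_tau tau_inside.
Qed.

End live_path.

(** * Law of large numbers for one pivot *)

Section one_pivot.
Context (R : realType) (alpha eps c : R) (beta : R -> R -> R) (u : nat -> R) (j : nat).
Hypothesis halpha : 0 <= alpha <= 1.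
Hypothesis hbeta : cost_function beta.
Hypotheses (heps4 : eps < 1 / 4) (c0 : 0 < c).
Hypothesis hc : forall u t, 0 < u -> u < t -> t < 1 -> beta u t <= c * (t - u) `^ (- eps).

Let V := pivot_at alpha u j.
Hypothesis pV : pivot V.
Let s : R := root4 V.1.
Let g : R := mean_cost beta V.

Definition total_cost (n : nat) : R := \sum_(j.+1 <= i < n) cost beta V (u i).

Let H := total_cost.
Let D n := deviation alpha beta u j n.

Definition pivot_energy : \bar R :=
  (\sum_(n <oo) ((D (n.+1 ^ 2) / (n.+1 ^ 2)%:R) ^+ 2 * weight V)%:E)%E.

Hypothesis energy_fin : (pivot_energy < +oo)%E.

Let s0 : 0 < s.
Proof. by apply: powR_gt0; case/and4P: pV => _ _ lt tr; rewrite subr_gt0 (lt_trans lt). Qed.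

Let g0 : 0 <= g. Proof. exact: mean_cost_ge0. Qed.

Let H0 n : 0 <= H n.
Proof. by apply: sumr_ge0 => i _; exact: cost_ge0. Qed.

Let ndH : {homo H : m n / (m <= n)%N >-> m <= n}.
Proof.
apply: homo_leq => [x|x y z|n]; [exact: lexx|exact: le_trans|].
rewrite /H /total_cost; have [jn|nj] := ltnP j n; last first.
  by rewrite !big_geq// ltnW.
by rewrite big_nat_recr//= lerDl cost_ge0.
Qed.

(** Truncated subtraction is right here: for [n <= j.+1] both sums are empty. *)
Let HE n : H n = D n + g * (n - j.+1)%N%:R.
Proof. by rewrite /D /deviation sumrB sumr_const_nat mulr_natr subrK. Qed.

Let y n : R := D (n.+1 ^ 2)%N / (n.+1 ^ 2)%:R.

Let yw_ge0 n : 0 <= y n ^+ 2 * weight V.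
Proof. by rewrite mulr_ge0 ?sqr_ge0 ?weight_ge0. Qed.

Let a n : R := H (n.+1 ^ 2)%N / (n.+1 ^ 2)%:R.

Let z n : R := (n.+1 ^ 2 - j.+1)%N%:R / (n.+1 ^ 2)%:R.

Let aE n : a n = y n + g * z n.
Proof. by rewrite /a HE mulrDl mulrA. Qed.

Let N0 n : 0 < (n.+1 ^ 2)%:R :> R.
Proof. by rewrite ltr0n expn_gt0. Qed.

Let z_le1 n : z n <= 1.
Proof. by rewrite /z ler_pdivrMr// mul1r ler_nat leq_subr. Qed.

(** Along squares, [y] tends to [0] because the energy series converges, and [z] tends to [1];
    monotonicity of [H] fills the gaps. *)
Lemma cvg_total_cost : H n / n%:R @[n --> \oo] --> g.
Proof.
apply: cvg_average_squares => //.
have y2 : y n ^+ 2 * weight V @[n --> \oo] --> (0 : R).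
  exact: (nneseries_cvg0 yw_ge0 energy_fin).
(* Multiplying by [s > 0] removes the weight, and a square root removes the square. *)
have cy : y n @[n --> \oo] --> (0 : R).
  have h : y n ^+ 2 * weight V * s @[n --> \oo] --> 0 * s by exact: cvgMl.
  have h' : y n ^+ 2 @[n --> \oo] --> (0 : R).
    move: h; rewrite mul0r; apply: cvg_trans; apply: near_eq_cvg; apply: nearW => n.
    by rewrite weightE -/s divfK// gt_eqF.
  apply/norm_cvg0P.
  have := cvg_comp _ _ h' (@sqrt_continuous R 0); rewrite sqrtr0.
  apply: cvg_trans; apply: near_eq_cvg; apply: nearW => n /=.
  by rewrite sqrtr_sqr.
(* [z n] lies between [1 - (j + 1) / (n + 1)] and [1]. *)
have cz : z n @[n --> \oo] --> (1 : R).
  have lo : 1 - j.+1%:R * harmonic n @[n --> \oo] --> (1 - j.+1%:R * 0 : R).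
    by apply: cvgB; [exact: cvg_cst|apply: cvgMr; exact: cvg_harmonic].
  rewrite mulr0 subr0 in lo.
  apply: (@squeeze_cvgr _ _ _ _ (fun n => 1 - j.+1%:R * harmonic n) (fun=> 1));
    [apply: nearW => n|exact: lo|exact: cvg_cst].
  rewrite z_le1 andbT /z ler_pdivlMr// mulrBl mul1r lerBlDr.
  apply: (@le_trans _ _ ((n.+1 ^ 2 - j.+1)%N%:R + j.+1%:R)).
    by rewrite -natrD ler_nat addnC -leq_subLR.
  rewrite lerD2l natrX /harmonic/=.
  have n0 : 0 < n.+1%:R :> R by rewrite ltr0n.
  have -> : j.+1%:R * n.+1%:R^-1 * n.+1%:R ^+ 2 = j.+1%:R * n.+1%:R :> R.
    by field; rewrite gt_eqF.
  by rewrite -[leLHS]mulr1 ler_wpM2l// ler1n.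
have h : y n + g * z n @[n --> \oo] --> 0 + g * 1.
  by apply: cvgD => //; exact: cvgMr.
move: h; rewrite add0r mulr1; apply: cvg_trans; apply: near_eq_cvg; apply: nearW => n.
by rewrite -aE.
Qed.

(** With [q] the energy, [y^2 <= q s] gives [y <= (q + s) / 2], and [g <= (4 c^2 + 1) s]. Passing
    from squares to all [n] multiplies the sum of these bounds by [4]. *)
Lemma total_cost_le n : ((H n / n%:R)%:E <=
  2%:E * pivot_energy + ((2 + 4 * (4 * c ^+ 2 + 1)) * s)%:E)%E.
Proof.
have Q0 : (0 <= pivot_energy)%E.
  by apply: nneseries_ge0 => k _ _; rewrite lee_fin; exact: yw_ge0.
have QE : pivot_energy = (fine pivot_energy)%:E by rewrite fineK// ge0_fin_numE.
set q := fine pivot_energy in QE.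
have q0 : 0 <= q by exact: fine_ge0.
have yq k : y k ^+ 2 * weight V <= q.
  by apply: (nneseries_term_le yw_ge0); rewrite -QE.
have yb k : y k <= (q + s) / 2.
  apply: (le_trans (ler_norm _)).
  have qs0 : 0 <= (q + s) / 2 by rewrite divr_ge0// addr_ge0// ltW.
  rewrite -(@ler_pXn2r _ 2) ?nnegrE// real_normK ?num_real//.
  have : y k ^+ 2 <= q * s by rewrite -ler_pdivrMr// -weightE; exact: yq.
  move=> /le_trans; apply; rewrite -subr_ge0.
  have -> : ((q + s) / 2) ^+ 2 - q * s = ((q - s) / 2) ^+ 2 by field.
  exact: sqr_ge0.
have gs : g <= (4 * c ^+ 2 + 1) * s.
  by have := mean_cost_le hbeta heps4 c0 hc V; rewrite pV mulr1.
have B0 : 0 <= (q + s) / 2 + g by rewrite addr_ge0// divr_ge0// addr_ge0// ltW.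
rewrite QE -EFinM -EFinD lee_fin.
apply: (le_trans (average_le_squares H0 ndH B0 _ n)); last by lra.
move=> k; rewrite -/(a k) aE lerD//.
by rewrite -[leRHS]mulr1 ler_wpM2l.
Qed.

End one_pivot.

Theorem theorem3p4 (d : measure_display) (T : measurableType d) (R : realType)
    (P : probability T R) (alpha eps : R) (beta : R -> R -> R)
    (U : nat -> {RV P >-> R})
    (halpha : 0 <= alpha <= 1)
    (hbeta : cost_function beta)
    (heps : 0 < eps) (heps4 : eps < 1 / 4)
    (htame : tame eps beta)
    (hU : iid_uniform01 U) :
  {ae P, forall w,
    let u := fun i => U i w in
    quickval_limit alpha beta u \is a fin_num /\
    (quickval_cost alpha beta u n * (n%:R^-1)%:E)%E @[n --> \oo]
      --> quickval_limit alpha beta u}.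
Proof.
have [c c0 hc] := htame.
have h1 := ae_deviation halpha hbeta heps4 c0 hc hU.
have h2 := ae_root4_pivot halpha hU.
have h3 := ae_root4 halpha hU.
have h4 := ae_seed_neq hU alpha.
(* Four almost sure events are intersected; from here on the argument is deterministic, on one
   path. *)
apply: (filterS _ (filterI (filterI h1 h2) (filterI h3 h4))) => w [[h1w h2w] [h3w h4w]].
set u := (fun i => U i w).
have energy : (\sum_(j <oo) pivot_energy alpha beta u j < +oo)%E by exact: h1w.
have roots : (\sum_(j <oo) (root4 (live alpha u j) *
    (pivot (pivot_at alpha u j))%:R)%:E < +oo)%E by exact: h2w.
have root4_sum : (\sum_(j <oo) (root4 (live alpha u j) ^+ 5)%:E < +oo)%E by exact: h3w.
have u_neq i : u i != alpha by exact: h4w.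
clear h1 h2 h3 h4 h1w h2w h3w h4w.
pose t k := tau alpha u k.+1.
have t_lt k : (t k < t k.+1)%N by exact: (tau_lt root4_sum u_neq).
have pt k : pivot (pivot_at alpha u (t k)) by exact: (pivot_tau halpha root4_sum u_neq).
have Q0 j : (0 <= pivot_energy alpha beta u j)%E.
  by apply: nneseries_ge0 => n _ _; rewrite lee_fin mulr_ge0 ?sqr_ge0 ?weight_ge0.
have r0 j : (0 <= (root4 (live alpha u j) * (pivot (pivot_at alpha u j))%:R)%:E)%E.
  by rewrite lee_fin mulr_ge0 ?root4_ge0.
(* One infinite term would make the whole energy series infinite. *)
have Qt k : (pivot_energy alpha beta u (t k) < +oo)%E.
  rewrite ltNge leye_eq; apply/negP => /eqP Qoo; move: energy.
  by rewrite (nneseries_pinfty _ _ Qoo).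
pose C : R := 2 + 4 * (4 * c ^+ 2 + 1).
have C0 : 0 <= C by rewrite /C; have := sqr_ge0 c; lra.
(* At a pivot the interval in [cost] is that of the step, by [live_tau], so the guard of the sum
   becomes the zero value of [cost]. *)
have costE n k : step_cost alpha beta u n k.+1 = total_cost alpha beta u (t k) n.
  rewrite /step_cost /total_cost big_mkcond; apply: eq_bigr => i _.
  by rewrite /cost pt/= /pivot_at/= (live_tau root4_sum u_neq).
have integralE k : step_integral alpha beta u k.+1 = (mean_cost beta (pivot_at alpha u (t k)))%:E.
  rewrite /step_integral -(mean_cost_lebesgue hbeta heps4 c0 hc (pt k)).
  by rewrite /pivot_at/= (live_tau root4_sum u_neq).
have limE : quickval_limit alpha beta u =
    (\sum_(k <oo) (mean_cost beta (pivot_at alpha u (t k)))%:E)%E.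
  rewrite /quickval_limit nneseries_shift1; first exact: eq_eseriesr.
  by move=> k; rewrite integralE lee_fin; exact: mean_cost_ge0.
have tc0 n k : 0 <= total_cost alpha beta u (t k) n.
  by apply: sumr_ge0 => i _; exact: cost_ge0.
have avgE n : (quickval_cost alpha beta u n * (n%:R^-1)%:E =
    \sum_(k <oo) (total_cost alpha beta u (t k) n / n%:R)%:E)%E.
  rewrite /quickval_cost nneseries_shift1; last by move=> k; rewrite lee_fin costE.
  rewrite muleC -nneseriesZl; last by move=> k _; rewrite lee_fin costE.
  by apply: eq_eseriesr => k _; rewrite costE -EFinM mulrC.
suff [hfin hcvg] : (\sum_(k <oo) (mean_cost beta (pivot_at alpha u (t k)))%:E \is a fin_num /\
    \sum_(k <oo) (total_cost alpha beta u (t k) n / n%:R)%:E @[n --> \oo] -->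
    \sum_(k <oo) (mean_cost beta (pivot_at alpha u (t k)))%:E)%E.
  rewrite limE; split => //; move: hcvg; apply: cvg_trans; apply: near_eq_cvg.
  by apply: nearW => n; rewrite -avgE.
apply: (@nneseries_dominated _ _ _ (fun k => 2%:E * pivot_energy alpha beta u (t k) +
  C%:E * (root4 (live alpha u (t k)) * (pivot (pivot_at alpha u (t k)))%:R)%:E)%E).
- by move=> n k; rewrite divr_ge0.
- move=> n k; have := total_cost_le hbeta heps4 c0 hc (pt k) (Qt k) n.
  by rewrite -EFinM pt mulr1.
- rewrite nneseriesD; last 2 first.
  + by move=> k _ _; rewrite mule_ge0.
  + by move=> k _ _; rewrite mule_ge0// lee_fin.
  rewrite !nneseriesZl//.
  (* Since [t] is strictly increasing, the dominating series over the pivots is controlled by the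
     two series over all indices. *)
  have h1 := le_lt_trans (nneseries_increasing_le Q0 t_lt) energy.
  have h2 := le_lt_trans (nneseries_increasing_le r0 t_lt) roots.
  apply: lte_add_pinfty.
    by apply: (lte_mul_pinfty _ _ h1); rewrite ?lee_fin.
  by apply: (lte_mul_pinfty _ _ h2); rewrite ?lee_fin.
- by move=> k; exact: (cvg_total_cost hbeta (pt k) (Qt k)).
Qed.
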